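(* For every triangulation $\mathcal{T}$ of the pinched torus, with $n_0^{\mathcal{T}}$ vertices, $n_1^{\mathcal{T}}$ edges and $n_2^{\mathcal{T}}$ triangles, one has $$n_0^{\mathcal{T}} - n_1^{\mathcal{T}} + n_2^{\mathcal{T}} = 1.$$
   Context: The pinched torus is the (singular) surface in $\mathbb{R}^3$ given as the set of points $(x,y,z)$ with $$x = \left(a + b\cos(v)\cos\left(\tfrac{1}{2}u\right)\right)\cos(u),\quad y = \left(a + b\cos(v)\cos\left(\tfrac{1}{2}u\right)\right)\sin(u),\quad z = b\sin(v)\cos\left(\tfrac{1}{2}u\right),$$ for $u, v \in [0,2\pi]$, where $a > b > 0$ are the large and small radii respectively. A finite simplicial complex $C$ of dimension 2 is a finite set of simplices (triangles, edges, vertices) such that every face of a simplex belongs to $C$ and the intersection of any two simplices is either empty or a common face of both; $|C|$ denotes its geometric realization. A triangulation of a surface $S$ (here the pinched torus) is a pair $(C,\varphi)$ with $C$ such a complex and $\varphi : |C| \to S$ a homeomorphism; its numbers of vertices, edges and triangles are those of $C$. *)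

(* Defs.v *)
From HB Require Import structures.
From mathcomp Require Import all_boot all_order all_algebra finmap.
From mathcomp Require Import all_classical all_reals all_analysis.

Set Implicit Arguments.
Unset Strict Implicit.
Unset Printing Implicit Defensive.

Import Order.TTheory GRing.Theory Num.Theory.
Import numFieldNormedType.Exports.

Local Open Scope classical_set_scope.
Local Open Scope ring_scope.

Definition pinched_torus_param (R : realType) (a b u v : R) : 'rV[R]_3 :=
  let rho := a + b * cos v * cos (u / 2) in
  \row_(i < 3) [:: rho * cos u; rho * sin u; b * sin v * cos (u / 2)]`_i.

Definition pinched_torus (R : realType) (a b : R) : set 'rV[R]_3 :=
  [set pinched_torus_param a b u v |
    u in [set u : R | 0 <= u <= 2 * pi] & v in [set v : R | 0 <= v <= 2 * pi]].

(* A simplex is encoded by its finite set [s] of vertices, which must be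
   affinely independent; the simplex itself is [fset_hull s]. *)
Definition affinely_independent (R : realType) (N : nat)
    (s : {fset 'rV[R]_N}) : Prop :=
  forall w : 'rV[R]_N -> R,
    \sum_(p <- s) w p = 0 -> \sum_(p <- s) w p *: p = 0 ->
    forall p, p \in s -> w p = 0.

Definition fset_hull (R : realType) (N : nat) (s : {fset 'rV[R]_N}) :
    set 'rV[R]_N :=
  [set x | exists w : 'rV[R]_N -> R,
     [/\ forall p, p \in s -> 0 <= w p,
         \sum_(p <- s) w p = 1 & x = \sum_(p <- s) w p *: p]].

Definition is_face (R : realType) (N : nat) (t s : {fset 'rV[R]_N}) : Prop :=
  t != fset0 /\ (t `<=` s)%fset.

Definition num_simplices (R : realType) (N : nat)
    (C : {fset {fset 'rV[R]_N}}) (k : nat) : nat :=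
  #|` [fset s in C | #|` s| == k.+1]%fset|.

Record simplicial_complex2 (R : realType) (N : nat)
    (C : {fset {fset 'rV[R]_N}}) : Prop := {
  sc2_card : forall s, s \in C -> (1 <= #|` s| <= 3)%N;
  (* some simplex is a triangle: the dimension is exactly 2 *)
  sc2_dim : exists2 s, s \in C & #|` s| = 3%N;
  sc2_indep : forall s, s \in C -> affinely_independent s;
  sc2_face : forall s t, s \in C -> is_face t s -> t \in C;
  sc2_inter : forall s t, s \in C -> t \in C ->
    fset_hull s `&` fset_hull t = set0 \/
    exists f, [/\ is_face f s, is_face f t &
                  fset_hull s `&` fset_hull t = fset_hull f] }.

Definition realization (R : realType) (N : nat)
    (C : {fset {fset 'rV[R]_N}}) : set 'rV[R]_N :=
  \bigcup_(s in [set` C]) fset_hull s.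

(* [f] is a total function, but only its values on [A] matter. *)
Definition homeomorphism_on (T U : topologicalType)
    (A : set T) (B : set U) (f : T -> U) : Prop :=
  [/\ set_bij A B f, {within A, continuous f} &
      exists g : U -> T,
        {within B, continuous g} /\ forall x, A x -> g (f x) = x].

Definition triangulation (R : realType) (M N : nat) (S : set 'rV[R]_M)
    (C : {fset {fset 'rV[R]_N}}) (phi : 'rV[R]_N -> 'rV[R]_M) : Prop :=
  simplicial_complex2 C /\ homeomorphism_on (realization C) S phi.

(* Main.v *)
Require Import Defs.
From mathcomp Require Import all_boot all_order all_algebra finmap.
From mathcomp Require Import all_classical all_reals all_analysis.
From mathcomp Require Import ring lra.

(** The Euler characteristic is read off from first cohomology mod 2.

    The pinched torus is the double of a closed disc along its boundary circle,
    with the two centres identified as well: the half [y >= 0] and the half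
    [y <= 0] are both parametrised by the disc (the maps [sheet]), and they meet
    exactly in the boundary circle and in the pinch point.

    Cohomology is used in Alexander-Spanier form.  A class on a set [A] is a
    function [c : T -> T -> bool] that is additive near every point of [A]
    ([cocycle]); it is trivial if near every point it is the difference of one
    function [g] ([exact]).  Pulling back is composition, classes are trivial on
    convex sets ([exact_convex]), and primitives glue along covers as soon as
    they agree on overlaps ([exact_glue], [exact_transfer]).

    Let [n0], [n1], [n2] be the numbers of vertices, edges and triangles.

    [n1 + 1 <= n2 + n0] ([upper_bound]).  A mod 2 cochain on the edges gives
    a class [cochain_class] on the realization: label each point by a vertex
    with the largest (weighted) barycentric coordinate, and evaluate the cochain
    on pairs of labels.  It is additive near a point unless that point carries
    all three labels of a triangle on which the cochain has sum 1.  So the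
    cochains with sum 0 on all triangles except one, [t0], give classes on the
    surface with a single point removed.  There two nontrivial classes have a
    trivial sum ([punctured_torus_two_classes]), and a trivial class comes from
    a coboundary ([cochain_class_exact_edge]).  Hence a cochain is determined by
    its sums on the triangles other than [t0], one more bit, and a function on
    the vertices.

    [n2 + n0 <= n1 + 1] ([lower_bound]).  Remove a point from each triangle.
    The surface then carries [n2] classes: for each triangle but [t0], a class
    with residue 1 at the point of that triangle and no other residue except at
    the point of [t0] ([dipole]), and a class that detects the loop through the
    pinch point ([handle]).  If a combination of them has the holonomies of a
    coboundary along all edges, it is trivial on the 1-skeleton, hence on each
    punctured triangle ([exact_punctured_triangle]), so its residues vanish;
    what is left is a multiple of [handle], which would be trivial on the whole
    surface ([exact_realization]), and this is excluded by [handle_not_exact].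
    So combinations and vertex functions inject into edge cochains, up to one
    bit for the constant functions. *)

Set Implicit Arguments.
Unset Strict Implicit.
Unset Printing Implicit Defensive.

Import Order.TTheory GRing.Theory Num.Theory.
Import numFieldNormedType.Exports.

Local Open Scope classical_set_scope.
Local Open Scope ring_scope.

(** * Alexander-Spanier classes of degree one *)

Section Theory.
Context {T : topologicalType}.
Implicit Types (A B L X : set T) (c d : T -> T -> bool) (g h : T -> bool).

Definition locally_constant A g :=
  forall x, A x -> \forall y \near x, A y -> g y = g x.

(** Connectedness, tested by boolean functions; the empty set satisfies it. *)
Definition conn A :=
  forall g, locally_constant A g -> exists b, forall x, A x -> g x = b.

(** Additivity of [c] near [x]. Comparing all values with those at [x] itself
    gives the symmetric form [c y w = c y z (+) c z w] mod 2. *)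
Definition cocycle_at A c x := exists2 U, nbhs x U &
  forall y z, U y -> U z -> A y -> A z -> c y z = c x y (+) c x z.

Definition cocycle A c := forall x, A x -> cocycle_at A c x.

(** Only the values [c x y] at the centre [x] are constrained: for a cocycle the
    others follow. *)
Definition primitive A c g :=
  forall x, A x -> \forall y \near x, A y -> c x y = g x (+) g y.

Definition exact A c := exists g, primitive A c g.

Definition addc c d : T -> T -> bool := fun x y => c x y (+) d x y.

Lemma cocycle_atS A B c x : A `<=` B -> cocycle_at B c x -> cocycle_at A c x.
Proof. by move=> AB [U Ux H]; exists U => // y z Uy Uz /AB By /AB; exact: H. Qed.

Lemma cocycleS A B c : A `<=` B -> cocycle B c -> cocycle A c.
Proof.
by move=> AB cc x Ax; apply: cocycle_atS (AB) _; exact/cc/AB.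
Qed.

Lemma primitiveS A B c g : A `<=` B -> primitive B c g -> primitive A c g.
Proof.
move=> AB H x Ax; have := H x (AB _ Ax).
by apply: filterS => y + /AB; apply.
Qed.

Lemma exactS A B c : A `<=` B -> exact B c -> exact A c.
Proof. by move=> AB [g Hg]; exists g; apply: primitiveS AB Hg. Qed.

Lemma cocycle_atD A c d x :
  cocycle_at A c x -> cocycle_at A d x -> cocycle_at A (addc c d) x.
Proof.
move=> [U Ux HU] [V Vx HV]; exists (U `&` V); first exact: filterI.
move=> y z [Uy Vy] [Uz Vz] Ay Az; rewrite /addc HU// HV//.
by rewrite addbACA.
Qed.

Lemma cocycle_at_near A (U : set T) c d x :
  nbhs x U -> A x -> (forall y z, U y -> U z -> A y -> A z -> c y z = d y z) ->
  cocycle_at A c x -> cocycle_at A d x.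
Proof.
move=> Ux Ax E [V Vx H]; have Uxx := nbhs_singleton Ux.
exists (U `&` V); first exact: filterI.
by move=> y z [Uy Vy] [Uz Vz] Ay Az; rewrite -!E// H.
Qed.

Lemma cocycle_at_mask A (r : bool) c x :
  (r -> cocycle_at A c x) -> cocycle_at A (fun y z => r && c y z) x.
Proof. by case: r => [/(_ isT)//|_]; exists setT => //; exact: filterT. Qed.

Lemma cocycle_at_coboundary A g x :
  cocycle_at A (fun y z => g y (+) g z) x.
Proof.
exists setT; first exact: filterT.
by move=> y z _ _ _ _; case: (g x) (g y) (g z) => [] [] [].
Qed.

Lemma cocycle_at_big (I : Type) (r : seq I) A (c : I -> T -> T -> bool) x :
  (forall i, cocycle_at A (c i) x) ->
  cocycle_at A (fun y z => \big[addb/false]_(i <- r) c i y z) x.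
Proof.
move=> H; elim: r => [|i r IH].
  exists setT; first exact: filterT.
  by move=> y z _ _ _ _; rewrite !big_nil.
have -> : (fun y z => \big[addb/false]_(j <- i :: r) c j y z) =
    addc (c i) (fun y z => \big[addb/false]_(j <- r) c j y z).
  by apply/funext => y; apply/funext => z; rewrite big_cons.
exact: cocycle_atD.
Qed.

Lemma primitiveD A c d g h : primitive A c g -> primitive A d h ->
  primitive A (addc c d) (fun x => g x (+) h x).
Proof.
move=> Hg Hh x Ax; have := Hh x Ax; have := Hg x Ax.
by apply: filterS2 => y H1 H2 Ay; rewrite /addc H1// H2// addbACA.
Qed.

Lemma exactD A c d : exact A c -> exact A d -> exact A (addc c d).
Proof.
by move=> [g Hg] [h Hh]; exists (fun x => g x (+) h x); apply: primitiveD.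
Qed.

Lemma cocycle_at_refl A c x : cocycle_at A c x -> A x -> c x x = false.
Proof.
move=> [U Ux H] Ax; have Uxx := nbhs_singleton Ux.
by rewrite (H x x)// addbb.
Qed.

Lemma cocycle_refl A c x : cocycle A c -> A x -> c x x = false.
Proof. by move=> cc Ax; apply: cocycle_at_refl (cc x Ax) Ax. Qed.

Lemma primitive_pointwise A c g :
  (forall x y, A x -> A y -> c x y = g x (+) g y) -> primitive A c g.
Proof. by move=> H x Ax; apply: nearW => y Ay; exact: H. Qed.

Lemma primitive_const A c g b :
  primitive A c g -> primitive A c (fun x => g x (+) b).
Proof.
move=> H x Ax; have := H x Ax; apply: filterS => y H1 Ay.
by rewrite H1// addbACA addbb addbF.
Qed.

Lemma primitive_unique A c g h :
  primitive A c g -> primitive A c h ->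
  locally_constant A (fun x => g x (+) h x).
Proof.
move=> Hg Hh x Ax; have := Hh x Ax; have := Hg x Ax.
apply: filterS2 => y H1 H2 Ay; move: (H1 Ay); rewrite H2//.
by case: (g x) (g y) (h x) (h y) => [] [] [] [].
Qed.

Lemma primitive_conn A c g h : conn A ->
  primitive A c g -> primitive A c h ->
  exists b, forall x, A x -> g x = h x (+) b.
Proof.
move=> cA Hg Hh; have [b Hb] := cA _ (primitive_unique Hg Hh).
by exists b => x /Hb <-; rewrite addbCA addbb addbF.
Qed.

Lemma cocycle_open_exact A c q U : open U ->
  (forall y z, U y -> U z -> A y -> A z -> c y z = c q y (+) c q z) ->
  primitive (A `&` U) c (c q).
Proof.
move=> oU H x [Ax Ux]; have : nbhs x U by apply: open_nbhs_nbhs.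
by apply: filterS => y Uy [Ay _]; apply: H.
Qed.

(** The function [c q] is a primitive near [q]. *)
Lemma cocycle_local_exact A c q : cocycle_at A c q ->
  exists U, [/\ open U, U q & exact (A `&` U) c].
Proof.
move=> [U + HU]; rewrite nbhsE => -[V [oV Vq] VU]; exists V; split => //.
exists (c q); apply: cocycle_open_exact => // y z Vy Vz.
by apply: HU; apply: VU.
Qed.

Lemma conn_joined A :
  (forall x y, A x -> A y -> exists B, [/\ conn B, B `<=` A, B x & B y]) ->
  conn A.
Proof.
move=> H g Hg; case: (pselect (exists x, A x)) => [[x Ax]|nA]; last first.
  by exists false => x Ax; case: nA; exists x.
exists (g x) => y Ay; have [B [cB BA Bx By]] := H x y Ax Ay.
have [|b Hb] := cB g; last by rewrite !Hb.
move=> z Bz; have := Hg z (BA _ Bz).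
by apply: filterS => w + /BA; apply.
Qed.

Lemma locally_constantS A B g :
  A `<=` B -> locally_constant B g -> locally_constant A g.
Proof.
move=> AB H x Ax; have := H x (AB _ Ax).
by apply: filterS => y + /AB; apply.
Qed.

Lemma connU A B x : conn A -> conn B -> A x -> B x -> conn (A `|` B).
Proof.
move=> cA cB Ax Bx g Hg; exists (g x) => y; case=> [Ay|By].
  have [|b Hb] := cA g; last by rewrite !Hb.
  by apply: locally_constantS Hg => z; left.
have [|b Hb] := cB g; last by rewrite !Hb.
by apply: locally_constantS Hg => z; right.
Qed.

Lemma conn1 x : conn [set x].
Proof. by move=> g _; exists (g x) => y ->. Qed.

(** No algebra is involved: a point close to [x] shares with [x] a piece of the
    cover, on which the glued function is the given primitive. The hypothesis on
    the cover holds for open covers and for finite closed ones. *)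
Lemma exact_glue (I : finType) X (A : I -> set T) c (g : I -> T -> bool) :
  (forall x, X x -> \forall y \near x, X y -> exists i, A i x /\ A i y) ->
  (forall i, primitive (A i) c (g i)) ->
  (forall i j x, i != j -> A i x -> A j x -> g i x = g j x) ->
  exists2 h, primitive X c h & forall i x, X x -> A i x -> h x = g i x.
Proof.
move=> cov Hg agree.
have agree' i j x : A i x -> A j x -> g i x = g j x.
  by have [->//|ne] := eqVneq i j; exact: agree.
pose h x := if pselect (exists i, A i x) is left e then
  g (projT1 (cid e)) x else false.
have hE i x : A i x -> h x = g i x.
  move=> Ax; rewrite /h; case: pselect => [e|]; last by case; exists i.
  by apply: agree' => //; exact: (projT2 (cid e)).
exists h; last by move=> i x _; exact: hE.
move=> x Xx.
have H : \forall y \near x, forall i, A i x -> A i y -> c x y = g i x (+) g i y.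
  apply: filter_forall => i.
  case: (pselect (A i x)) => Ax; last by apply: nearW => y /Ax.
  by have := Hg i x Ax; apply: filterS => y + _.
have := H; have := cov x Xx; apply: filterS2 => y H1 H2 Xy.
by have [i [ix iy]] := H1 Xy; rewrite !(hE i)//; exact: H2.
Qed.

Lemma closed_cover_near (I : finType) X (F : I -> set T) :
  (forall i, closed (F i)) ->
  (forall x, X x -> exists i, F i x) ->
  forall x, X x -> \forall y \near x, X y -> exists i, F i x /\ F i y.
Proof.
move=> cF cov x Xx.
have H : \forall y \near x, forall i, F i y -> F i x.
  apply: filter_forall => i.
  case: (pselect (F i x)) => Fx; first by apply: nearW.
  have : nbhs x (~` F i) by apply: open_nbhs_nbhs; split => //; exact: closed_openC.
  by apply: filterS => y nFy /nFy.
by apply: filterS H => y H Xy; have [i Fy] := cov y Xy; exists i; split => //; exact: H.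
Qed.

(** A primitive on [L] normalises the primitives on the pieces [A i]: these are
    made equal to it on the connected set [M i]. On an overlap two of them differ
    by a constant along [B], and the constant is zero where [B] meets both [M i]
    and [M j]. *)
Lemma exact_transfer (I : finType) X L (A M : I -> set T) c :
  (forall x, X x -> \forall y \near x, X y -> exists i, A i x /\ A i y) ->
  (forall i, exact (A i) c) -> exact L c ->
  (forall i, M i `<=` L `&` A i) -> (forall i, conn (M i)) ->
  (forall i j x, i != j -> A i x -> A j x ->
     exists B, [/\ conn B, B `<=` A i `&` A j, B x &
                   exists y, [/\ B y, M i y & M j y]]) ->
  exact X c.
Proof.
move=> cov exA [gL HL] ML cM ov.
have /choice [g Hg] : forall i, exists g, primitive (A i) c g /\
    (forall x, M i x -> g x = gL x).
  move=> i; have [g Hg] := exA i.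
  have [||b Hb] := @primitive_conn (M i) c gL g (cM i).
  - by apply: primitiveS HL => x /ML[].
  - by apply: primitiveS Hg => x /ML[].
  exists (fun x => g x (+) b); split; last by move=> x /Hb ->.
  exact: primitive_const.
have [||h Hh _] := @exact_glue I X A c g cov _; last by exists h.
- by move=> i; case: (Hg i).
- move=> i j x ij Ai Aj; have [B [cB BA Bx [y [By Mi My]]]] := ov i j x ij Ai Aj.
  have [||b Hb] := @primitive_conn B c (g i) (g j) cB.
  + by apply: primitiveS (Hg i).1 => z /BA[].
  + by apply: primitiveS (Hg j).1 => z /BA[].
  have := Hb y By; rewrite (Hg i).2// (Hg j).2// => /eqP.
  rewrite Hb//; case: b {Hb}; last by rewrite !addbF.
  by case: (gL y).
Qed.

Section TwoPieces.
Variables (X A B : set T).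
Hypothesis cov :
  forall x, X x -> \forall y \near x, X y -> (A x /\ A y) \/ (B x /\ B y).

Lemma exact_glue2 c g h : primitive A c g -> primitive B c h ->
  (forall x, A x -> B x -> g x = h x) -> exact X c.
Proof.
move=> Hg Hh E.
have [|||k Hk _] := @exact_glue bool X (fun b => if b then A else B) c
  (fun b => if b then g else h); last by exists k.
- move=> x Xx; have := cov Xx; apply: filterS => y H /H[]; first by exists true.
  by exists false.
- by case.
- by move=> [] [] x //= _ H1 H2; rewrite E.
Qed.

Lemma exactU c : conn (A `&` B) -> exact A c -> exact B c -> exact X c.
Proof.
move=> cAB [g Hg] [h Hh].
have [||b Hb] := @primitive_conn (A `&` B) c g h cAB.
- by apply: primitiveS Hg => x [].
- by apply: primitiveS Hh => x [].
apply: (exact_glue2 Hg (primitive_const b Hh)) => x Ax Bx.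
exact: Hb.
Qed.

(** Primitives on [A] and on [B] differ by one bit on each of the parts [S1] and
    [S2] of the intersection. The class is trivial when the two bits agree, and
    for two nontrivial classes the disagreements cancel in the sum. This bounds
    the first cohomology group of a union by one dimension. *)
Lemma two_pieces S1 S2 c d : conn S1 -> conn S2 -> A `&` B = S1 `|` S2 ->
  exact A c -> exact B c -> exact A d -> exact B d ->
  [\/ exact X c, exact X d | exact X (addc c d)].
Proof.
move=> c1 c2 AB [ga Ha] [gb Hb] [ka Ka] [kb Kb].
have sub1 : S1 `<=` A `&` B by rewrite AB; left.
have sub2 : S2 `<=` A `&` B by rewrite AB; right.
have cst S e u v : conn S -> S `<=` A `&` B -> primitive A e u -> primitive B e v ->
    exists b, forall x, S x -> u x = v x (+) b.
  move=> cS sub Hu Hv; apply: primitive_conn cS _ _.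
    by apply: primitiveS Hu => x /sub[].
  by apply: primitiveS Hv => x /sub[].
have [b1 B1] := cst _ _ _ _ c1 sub1 Ha Hb.
have [b2 B2] := cst _ _ _ _ c2 sub2 Ha Hb.
have [d1 D1] := cst _ _ _ _ c1 sub1 Ka Kb.
have [d2 D2] := cst _ _ _ _ c2 sub2 Ka Kb.
have fin e u v b : primitive A e u -> primitive B e v ->
    (forall x, S1 x -> u x = v x (+) b) -> (forall x, S2 x -> u x = v x (+) b) ->
    exact X e.
  move=> Hu Hv E1 E2; apply: (exact_glue2 Hu (primitive_const b Hv)) => x Ax Bx.
  have : (A `&` B) x by split.
  by rewrite AB => -[/E1|/E2].
case: (eqVneq b1 b2) => [E|ne]; first by apply: Or31; apply: (fin c ga gb b1) => //; rewrite E.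
case: (eqVneq d1 d2) => [E|ne']; first by apply: Or32; apply: (fin d ka kb d1) => //; rewrite E.
apply: Or33; apply: (fin _ _ _ (b1 (+) d1) (primitiveD Ha Ka) (primitiveD Hb Kb)).
  by move=> x Sx; rewrite B1// D1// addbACA.
have -> : b1 (+) d1 = b2 (+) d2 by case: b1 b2 d1 d2 ne ne' {B1 B2 D1 D2} => [] [] [] [].
by move=> x Sx; rewrite B2// D2// addbACA.
Qed.

End TwoPieces.
End Theory.

Section Pullback.
Context {S T : topologicalType}.
Implicit Types (A : set S) (B : set T) (f : S -> T).

Definition cont_on A f :=
  forall x, A x -> forall U, nbhs (f x) U -> \forall y \near x, A y -> U (f y).

Definition pullback f (c : T -> T -> bool) : S -> S -> bool :=
  fun x y => c (f x) (f y).

Lemma continuous_cont_on A f : continuous f -> cont_on A f.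
Proof.
move=> cf x Ax U Ux; have := cf x U Ux.
by rewrite nbhs_simpl /=; apply: filterS.
Qed.

Lemma within_cont_on A f : {within A, continuous f} -> cont_on A f.
Proof.
move=> /subspace_continuousP cf x Ax U Ux; have := cf x Ax U Ux.
by rewrite nbhs_simpl /= /within.
Qed.

Lemma cont_onS A A' f : A `<=` A' -> cont_on A' f -> cont_on A f.
Proof.
move=> AA H x Ax U Ux; have := H x (AA _ Ax) U Ux.
by apply: filterS => y + /AA; apply.
Qed.

Lemma conn_image A f : conn A -> cont_on A f -> conn (f @` A).
Proof.
move=> cA cf g Hg; have [|b Hb] := cA (g \o f).
  move=> x Ax; have fAx : (f @` A) (f x) by exists x.
  by have := cf x Ax _ (Hg _ fAx); apply: filterS => y /= H Ay; apply: H => //; exists y.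
by exists b => _ [x Ax <-]; exact: Hb.
Qed.

Lemma cocycle_at_pullback A B f c x : cont_on A f ->
  (forall x, A x -> B (f x)) -> A x -> cocycle_at B c (f x) ->
  cocycle_at A (pullback f c) x.
Proof.
move=> cf AB Ax [U Ux H]; exists [set y | A y -> U (f y)]; first exact: cf.
by move=> y z Vy Vz Ay Az; apply: H; [exact: Vy|exact: Vz|exact: AB|exact: AB].
Qed.

Lemma cocycle_pullback A B f c : cont_on A f -> (forall x, A x -> B (f x)) ->
  cocycle B c -> cocycle A (pullback f c).
Proof.
move=> cf AB cc x Ax; apply: (@cocycle_at_pullback A B) => //.
exact/cc/AB.
Qed.

Lemma primitive_pullback A B f c g : cont_on A f -> (forall x, A x -> B (f x)) ->
  primitive B c g -> primitive A (pullback f c) (g \o f).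
Proof.
move=> cf AB H x Ax; have := cf x Ax _ (H (f x) (AB _ Ax)).
by apply: filterS => y H1 Ay; apply: H1 => //; exact: AB.
Qed.

Lemma exact_pullback A B f c : cont_on A f -> (forall x, A x -> B (f x)) ->
  exact B c -> exact A (pullback f c).
Proof.
by move=> cf AB [g Hg]; exists (g \o f); apply: primitive_pullback Hg.
Qed.

End Pullback.

(** Exactness can be tested on a model [A] of [B]. *)
Lemma exact_section (S T : topologicalType) (A : set S) (B : set T)
    (f : S -> T) (r : T -> S) c :
  cont_on B r -> (forall y, B y -> A (r y)) -> (forall y, B y -> f (r y) = y) ->
  exact A (pullback f c) -> exact B c.
Proof.
move=> cr BA fr /(exact_pullback cr BA) [g Hg]; exists g => y By.
by have := Hg y By; apply: filterS => z H Bz; have := H Bz; rewrite /pullback !fr.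
Qed.

(** * Cocycles on convex sets *)

Section Interval.
Variable R : realType.

(** A property of subintervals that can be concatenated and that holds for all
    short enough intervals around each point holds for the unit interval: consider
    the supremum of the [t] for which it holds on [[0, t]]. *)
Lemma interval_induction (Q : R -> R -> Prop) :
  (forall a b d : R, 0 <= a -> d <= 1 -> a <= b -> b <= d -> Q a b -> Q b d -> Q a d) ->
  (forall t : R, 0 <= t <= 1 -> exists2 e : R, 0 < e & forall a b : R, 0 <= a -> b <= 1 ->
      a <= b -> `|a - t| < e -> `|b - t| < e -> Q a b) ->
  Q 0 1.
Proof.
move=> Qcat Qloc; pose E := [set t | 0 <= t <= 1 /\ Q 0 t].
have E0 : E 0.
  split; first by rewrite lexx ler01.
  have [|e e0 He] := Qloc 0; first by rewrite lexx ler01.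
  by apply: He => //; rewrite subrr normr0.
have supE : has_sup E.
  by split; [exists 0 | exists 1 => t [/andP[]]].
have s0 : 0 <= sup E by apply: ub_le_sup => //; case: supE.
have s1 : sup E <= 1 by apply: ge_sup => [|t [/andP[]]//]; case: supE.
have [|e e0 He] := Qloc (sup E); first by rewrite s0 s1.
have [t [/andP[t0 t1] Qt] te] := sup_adherent e0 supE.
have ts : t <= sup E by apply: ub_le_sup; [case: supE|split => //; rewrite t0 t1].
pose m := Num.min 1 (sup E + e / 2).
have m1 : m <= 1 by rewrite /m ge_min lexx.
have sm : sup E <= m by rewrite /m le_min s1 lerDl divr_ge0// ltW.
have me : m <= sup E + e / 2 by rewrite /m ge_min lexx orbT.
have Em : E m.
  split; first by rewrite m1 andbT (le_trans s0).
  apply: (Qcat 0 t m) => //; first exact: le_trans sm.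
  apply: He => //; first exact: le_trans sm.
    by rewrite ler0_norm ?subr_le0//; lra.
  by rewrite ger0_norm ?subr_ge0//; lra.
have ms : m <= sup E by apply: ub_le_sup => //; case: supE.
have <- : m = 1; last by case: Em.
apply/eqP; rewrite eq_le m1 /=; rewrite leNgt; apply/negP => mlt.
have [H|/ltW H] := leP 1 (sup E + e / 2).
  by move: mlt; rewrite /m (min_idPl H) ltxx.
by have := ms; rewrite /m (min_idPr H); lra.
Qed.

Definition unit_interval : set R := [set t | 0 <= t <= 1].

Lemma near_norm (t : R) (P : R -> Prop) : (\forall s \near t, P s) ->
  exists2 e, 0 < e & forall s, `|s - t| < e -> P s.
Proof.
move=> /nbhs_ballP[e /= e0 H]; exists e => // s st; apply: H.
by rewrite -ball_normE /= distrC.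
Qed.

Lemma conn_unit_interval : conn unit_interval.
Proof.
move=> g Hg; exists (g 0).
suff H s : unit_interval s -> g 0 = g s by move=> x /H.
move=> /andP[s0 s1].
suff : g (s * 0) = g (s * 1) by rewrite mulr0 mulr1.
have sI (r : R) : 0 <= r <= 1 -> unit_interval (s * r).
  by move=> /andP[r0 r1]; apply/andP; split; nra.
apply: (@interval_induction (fun a b => g (s * a) = g (s * b))).
  by move=> a b d _ _ _ _ -> ->.
move=> t tI; have [e e0 He] := near_norm (Hg _ (sI _ tI)).
exists e => // a b a0 b1 ab ta tb.
have st (r : R) : `|r - t| < e -> `|s * r - s * t| < e.
  rewrite -mulrBr normrM ger0_norm// => H; apply: le_lt_trans H.
  by rewrite ler_piMl.
by rewrite !He//; try exact: st; apply: sI; apply/andP; split => //; lra.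
Qed.

End Interval.

Section Convex.
Variables (R : realType) (V : normedModType R).
Implicit Types (A B : set V) (x y z : V).

Definition convexly_closed A :=
  forall x y (t : R), A x -> A y -> 0 <= t <= 1 -> A ((1 - t) *: x + t *: y).

Lemma convexly_closedI A B :
  convexly_closed A -> convexly_closed B -> convexly_closed (A `&` B).
Proof. by move=> cA cB x y t [Ax Bx] [Ay By] t01; split; [exact: cA|exact: cB]. Qed.

Lemma segment_continuous x y : continuous (fun t : R => (1 - t) *: x + t *: y).
Proof.
move=> t; apply: cvgD; last by apply: cvgZr_tmp.
by apply: cvgZr_tmp; apply: cvgB => //; exact: cvg_cst.
Qed.

Lemma conn_convex A : convexly_closed A -> conn A.
Proof.
move=> cA; apply: conn_joined => x y Ax Ay.
exists ((fun t : R => (1 - t) *: x + t *: y) @` @unit_interval R); split.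
- apply: conn_image; first exact: conn_unit_interval.
  apply: continuous_cont_on => t; apply: segment_continuous.
- by move=> _ [t t01 <-]; exact: cA.
- by exists 0; rewrite /= ?/unit_interval /= ?lexx ?ler01// subr0 scale1r scale0r addr0.
- by exists 1; rewrite /= ?/unit_interval /= ?lexx ?ler01// subrr scale1r scale0r add0r.
Qed.

End Convex.

Section Plane.
Variable R : realType.
Implicit Types (p q : R * R).

Lemma near_pair p (P : R * R -> Prop) : (\forall q \near p, P q) <->
  exists2 e : R, 0 < e & forall q, `|q.1 - p.1| < e -> `|q.2 - p.2| < e -> P q.
Proof.
split=> [/nbhs_ballP[e /= e0 H]|[e e0 H]].
  by exists e => // q q1 q2; apply: H; split; rewrite -ball_normE /= distrC.
apply/nbhs_ballP; exists e => // q [] /=.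
by rewrite -!ball_normE /= => q1 q2; apply: H; rewrite distrC.
Qed.

Lemma pair_continuous (T : topologicalType) (f g : T -> R) :
  continuous f -> continuous g -> continuous (fun t => (f t, g t)).
Proof. by move=> cf cg t; exact: (cvg_pair (cf t) (cg t)). Qed.

Definition unit_square : set (R * R) :=
  [set p | 0 <= p.1 <= 1 /\ 0 <= p.2 <= 1].

Lemma convex_box (a b d e : R) :
  convexly_closed [set p : R * R | a <= p.1 <= b /\ d <= p.2 <= e].
Proof.
move=> [x1 x2] [y1 y2] t /= [/andP[h1 h2] /andP[h3 h4]]
  [/andP[h5 h6] /andP[h7 h8]] /andP[t0 t1].
by rewrite /GRing.scale /=; split; apply/andP; split; nra.
Qed.

Lemma closed_halves1 (X : set (R * R)) (b : R) x : X x -> \forall y \near x, X y ->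
  ((X `&` [set p | p.1 <= b]) x /\ (X `&` [set p | p.1 <= b]) y) \/
  ((X `&` [set p | b <= p.1]) x /\ (X `&` [set p | b <= p.1]) y).
Proof.
move=> Xx; apply/near_pair; have [lt|gt|eq] := ltgtP x.1 b.
- exists (b - x.1); first by rewrite subr_gt0.
  move=> y; rewrite ltr_norml => /andP[_ h] _ Xy; left.
  by rewrite /setI /=; do !split=> //; lra.
- exists (x.1 - b); first by rewrite subr_gt0.
  move=> y; rewrite ltr_norml => /andP[h _] _ Xy; right.
  by rewrite /setI /=; do !split=> //; lra.
- exists 1 => // y _ _ Xy; case: (leP y.1 b) => h; [left|right];
  by rewrite /setI /=; do !split=> //; lra.
Qed.

Lemma closed_halves2 (X : set (R * R)) (b : R) x : X x -> \forall y \near x, X y ->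
  ((X `&` [set p | p.2 <= b]) x /\ (X `&` [set p | p.2 <= b]) y) \/
  ((X `&` [set p | b <= p.2]) x /\ (X `&` [set p | b <= p.2]) y).
Proof.
move=> Xx; apply/near_pair; have [lt|gt|eq] := ltgtP x.2 b.
- exists (b - x.2); first by rewrite subr_gt0.
  move=> y _; rewrite ltr_norml => /andP[_ h] Xy; left.
  by rewrite /setI /=; do !split=> //; lra.
- exists (x.2 - b); first by rewrite subr_gt0.
  move=> y _; rewrite ltr_norml => /andP[h _] Xy; right.
  by rewrite /setI /=; do !split=> //; lra.
- exists 1 => // y _ _ Xy; case: (leP y.2 b) => h; [left|right];
  by rewrite /setI /=; do !split=> //; lra.
Qed.

Let box (a b d e : R) : set (R * R) :=
  [set p | a <= p.1 <= b /\ d <= p.2 <= e].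

(** Interval induction twice: first along a vertical segment, for thin boxes
    around it, then over the vertical strips. Boxes and strips are concatenated
    along segments, which are connected. *)
Lemma exact_unit_square c : cocycle unit_square c -> exact unit_square c.
Proof.
move=> cc.
have stripE (a b : R) : 0 <= a -> b <= 1 -> box a b 0 1 `<=` unit_square.
  by move=> a0 b1 p [/andP[h1 h2] h]; split => //; apply/andP; split; lra.
suff : exact (box 0 1 0 1) c by [].
apply: (@interval_induction R (fun a b => exact (box a b 0 1) c)).
  move=> a b d a0 d1 ab bd ex1 ex2.
  apply: (@exactU _ (box a d 0 1) (box a b 0 1) (box b d 0 1)) => //.
  - move=> x Xx; have := closed_halves1 b Xx.
    apply: filterS => y H Xy; move: (H Xy).
    move: Xx Xy; rewrite /box /setI /=.
    by move=> [/andP[? ?] ?] [/andP[? ?] ?] [[[_ ?] [_ ?]]|[[_ ?] [_ ?]]];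
      [left|right]; do !split => //; apply/andP; split.
  - apply: conn_convex; apply: convexly_closedI; exact: convex_box.
move=> s /andP[s0 s1].
pose sbox (e d d' : R) := unit_square `&` box (s - e) (s + e) d d'.
have sboxS e e' d d' : e <= e' -> sbox e d d' `<=` sbox e' d d'.
  move=> ee p [? [/andP[? ?] ?]]; split => //; split => //.
  by apply/andP; split; lra.
have : exists2 e : R, 0 < e & exact (sbox e 0 1) c.
  apply: (@interval_induction R (fun d d' => exists2 e : R, 0 < e & exact (sbox e d d') c)).
    move=> a b d a0 d1 ab bd [e e0 ex1] [e' e'0 ex2].
    exists (Num.min e e'); first by rewrite lt_min e0.
    set m := Num.min e e'.
    have {}ex1 : exact (sbox m a b) c by apply: exactS ex1; apply: sboxS; rewrite ge_min lexx.
    have {}ex2 : exact (sbox m b d) c.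
      by apply: exactS ex2; apply: sboxS; rewrite ge_min lexx orbT.
    apply: (@exactU _ (sbox m a d) (sbox m a b) (sbox m b d)) => //.
    - move=> x Xx; have := closed_halves2 b Xx.
      apply: filterS => y H Xy; move: (H Xy).
      move: Xx Xy; rewrite /sbox /box /setI /=.
      by move=> [? [? /andP[? ?]]] [? [? /andP[? ?]]] [[[_ ?] [_ ?]]|[[_ ?] [_ ?]]];
        [left|right]; do !split => //; apply/andP; split.
    - apply: conn_convex; apply: convexly_closedI; apply: convexly_closedI; exact: convex_box.
  move=> t t01; have Sst : unit_square (s, t) by split; rewrite //= s0 s1.
  have [U [oU Ust exU]] := cocycle_local_exact (cc _ Sst).
  have /near_pair[e e0 He] : \forall p \near (s, t), U p by apply: open_nbhs_nbhs.
  exists e => // a b a0 b1 ab ta tb; exists (e / 2); first by rewrite divr_gt0.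
  apply: exactS exU => -[p1 p2] [Sp [/= /andP[h1 h2] /andP[h3 h4]]]; split => //.
  by move: ta tb; rewrite !ltr_norml => /andP[? ?] /andP[? ?];
    apply: He => /=; rewrite ltr_norml; apply/andP; split; lra.
move=> [e e0 ex]; exists e => // a b a0 b1 ab sa sb.
apply: exactS ex => p Bp; split; first exact: stripE Bp.
move: Bp sa sb => [/andP[? ?] ?]; rewrite !ltr_norml => /andP[? ?] /andP[? ?].
by split => //; apply/andP; split; lra.
Qed.

End Plane.

Section Poincare.
Variables (R : realType) (V : normedModType R).
Implicit Types (A : set V) (w x y z : V).

Let cone w y z (p : R * R) : V :=
  (1 - p.1) *: w + p.1 *: ((1 - p.2) *: y + p.2 *: z).

Let cone_continuous w y z : continuous (cone w y z).
Proof.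
have c1 : continuous (fun p : R * R => p.1) by move=> p; exact: cvg_fst.
have c2 : continuous (fun p : R * R => p.2) by move=> p; exact: cvg_snd.
have cB (f : R * R -> R) : continuous f -> continuous (fun p => 1 - f p).
  by move=> cf p; apply: cvgB; [exact: cvg_cst|exact: cf].
have cD (f g : R * R -> V) : continuous f -> continuous g -> continuous (fun p => f p + g p).
  by move=> cf cg p; apply: cvgD; [exact: cf|exact: cg].
have cZ (f : R * R -> R) (g : R * R -> V) : continuous f -> continuous g ->
    continuous (fun p => f p *: g p).
  by move=> cf cg p; apply: cvgZ; [exact: cf|exact: cg].
have cC (v : V) : continuous (fun p : R * R => v) by move=> p; exact: cvg_cst.
exact: (cD _ _ (cZ _ _ (cB _ c1) (cC w))
  (cZ _ _ c1 (cD _ _ (cZ _ _ (cB _ c2) (cC y)) (cZ _ _ c2 (cC z))))).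
Qed.

(** Poincare lemma. Fix a base point [w]; the primitive at [y] is the holonomy of
    the class along the segment from [w] to [y]. For [x] and [y] close together,
    pull the class back to the unit square by the cone over the segment from [x]
    to [y] with apex [w]; the class is exact there, and its primitive compares the
    two holonomies with the value [c x y] along the short side. *)
Lemma exact_convex A c : convexly_closed A -> cocycle A c -> exact A c.
Proof.
move=> cA cc.
case: (pselect (exists w, A w)) => [[w Aw]|nA]; last first.
  by exists xpredT => x Ax; case: nA; exists x.
have coneA y z p : A y -> A z -> unit_square p -> A (cone w y z p).
  by move=> Ay Az [p1 p2]; apply: (cA) => //; exact: cA.
have exC y z : A y -> A z -> exact (@unit_square R) (pullback (cone w y z) c).
  move=> Ay Az; apply: exact_unit_square; apply: cocycle_pullback cc; last by move=> p; exact: coneA.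
  by apply: continuous_cont_on => p; exact: cone_continuous.
pose hol y b := exists2 g, primitive (@unit_interval R)
  (pullback (fun t : R => (1 - t) *: w + t *: y) c) g & g 0 (+) g 1 = b.
have hol_unique y b b' : hol y b -> hol y b' -> b = b'.
  move=> [g Hg <-] [h Hh <-].
  have [d Hd] := primitive_conn (@conn_unit_interval R) Hg Hh.
  rewrite !Hd; first by case: (h 0) (h 1) d {Hd} => [] [] [].
    by rewrite /unit_interval /= lexx ler01.
  by rewrite /unit_interval /= lexx ler01.
(* the horizontal sides of the square give the holonomy along the two rays *)
have side y z (r : R) G : A y -> A z -> 0 <= r <= 1 ->
    primitive (@unit_square R) (pullback (cone w y z) c) G ->
    hol ((1 - r) *: y + r *: z) (G (0, r) (+) G (1, r)).
  move=> Ay Az r01 HG; exists (fun t => G (t, r)) => //.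
  have cr : continuous (fun t : R => (t, r)).
    by apply: pair_continuous => t; [exact: cvg_id|exact: cvg_cst].
  apply: (primitive_pullback (f := fun t : R => (t, r))) HG.
    by apply: continuous_cont_on => t; exact: cr.
  by move=> t t01; split.
have hol_exists y : A y -> exists b, hol y b.
  move=> Ay; have [G HG] := exC _ _ Ay Ay.
  exists (G (0, 0) (+) G (1, 0)).
  have -> : y = (1 - 0) *: y + 0 *: y by rewrite subr0 scale1r scale0r addr0.
  by apply: side; rewrite // lexx ler01.
have /choice[g Hg] : forall y, exists b, A y -> hol y b.
  move=> y; case: (pselect (A y)) => [/hol_exists[b ?]|?]; first by exists b.
  by exists true.
exists g => x Ax; have [U Ux HU] := cc x Ax.
have /nbhs_ballP[e /= e0 He] := Ux.
apply/nbhs_ballP; exists e => //= y xy Ay.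
have [G HG] := exC _ _ Ax Ay.
have := side _ _ 0 _ Ax Ay _ HG; rewrite subr0 scale1r scale0r addr0 lexx ler01.
move=> /(_ isT) /(hol_unique _ _ _ (Hg _ Ax)) ->.
have := side _ _ 1 _ Ax Ay _ HG; rewrite subrr scale1r scale0r add0r lexx ler01.
move=> /(_ isT) /(hol_unique _ _ _ (Hg _ Ay)) ->.
have cr (r : R) : continuous (fun t : R => (r, t)).
  by apply: pair_continuous => t; [exact: cvg_cst|exact: cvg_id].
have i0 : @unit_interval R 0 by rewrite /unit_interval /= lexx ler01.
have i1 : @unit_interval R 1 by rewrite /unit_interval /= lexx ler01.
have vert (r : R) : 0 <= r <= 1 -> primitive (@unit_interval R)
    (pullback (fun t : R => cone w x y (r, t)) c) (fun t => G (r, t)).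
  move=> r01; apply: (primitive_pullback (f := fun t : R => (r, t))) HG.
    by apply: continuous_cont_on => t; exact: cr.
  by move=> t t01; split.
have E0 : G (0, 0) = G (0, 1).
  have const0 : primitive (@unit_interval R)
      (pullback (fun t : R => cone w x y (0, t)) c) (fun=> false).
    apply: primitive_pointwise => t s _ _.
    by rewrite /pullback /cone /= !subr0 !scale0r !scale1r !addr0 (cocycle_refl cc Aw).
  have [d Hd] := primitive_conn (@conn_unit_interval R) (vert 0 i0) const0.
  by rewrite !Hd.
have seg t : @unit_interval R t -> A (cone w x y (1, t)) /\ U (cone w x y (1, t)).
  move=> t01; split; first by apply: coneA.
  apply: He; rewrite -ball_normE /= /cone /= subrr scale0r add0r scale1r.
  have -> : x - ((1 - t) *: x + t *: y) = t *: (x - y).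
    by rewrite scalerBl scale1r scalerBr opprD opprB addrA addrCA subrr addr0.
  move: xy; rewrite -ball_normE /= normrZ; apply: le_lt_trans.
  by case/andP: t01 => ? ?; rewrite ger0_norm// ler_piMl.
have seg_primitive : primitive (@unit_interval R)
    (pullback (fun t : R => cone w x y (1, t)) c) (fun t => c x (cone w x y (1, t))).
  apply: primitive_pointwise => t s t01 s01; rewrite /pullback.
  by have [? ?] := seg _ t01; have [? ?] := seg _ s01; exact: HU.
have [d Hd] := primitive_conn (@conn_unit_interval R) (vert 1 i1) seg_primitive.
have -> : c x y = G (1, 0) (+) G (1, 1).
  rewrite !Hd// /cone /= subrr !scale0r !add0r !scale1r subr0.
  rewrite scale1r addr0 (cocycle_refl cc Ax).
  by case: (c x y) d {Hd} => [] [].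
by rewrite E0; case: (G (0, 1)) (G (1, 0)) (G (1, 1)) => [] [] [].
Qed.

End Poincare.

(** * Continuity of real functions *)

Section RealContinuity.
Variables (R : realType) (T : topologicalType).
Implicit Types (f g : T -> R) (r : R).

Lemma continuousDf f g : continuous f -> continuous g -> continuous (fun t => f t + g t).
Proof. by move=> cf cg t; apply: cvgD; [exact: cf|exact: cg]. Qed.

Lemma continuousMf f g : continuous f -> continuous g -> continuous (fun t => f t * g t).
Proof. by move=> cf cg t; apply: cvgM; [exact: cf|exact: cg]. Qed.

Lemma continuous_constant r : continuous (fun _ : T => r).
Proof. by move=> t; exact: cvg_cst. Qed.

Lemma continuousMc f r : continuous f -> continuous (fun t => f t * r).
Proof. by move=> cf; apply: continuousMf => //; exact: continuous_constant. Qed.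

Lemma continuousBc f r : continuous f -> continuous (fun t => f t - r).
Proof. by move=> cf; apply: continuousDf => //; exact: continuous_constant. Qed.

Lemma continuous_sqr f : continuous f -> continuous (fun t => f t ^+ 2).
Proof. by move=> cf; apply: continuousMf. Qed.

Lemma continuous_sqrt f : continuous f -> continuous (fun t => Num.sqrt (f t)).
Proof.
move=> cf t; apply: (@continuous_comp _ _ _ f Num.sqrt); first exact: cf.
exact: sqrt_continuous.
Qed.

Lemma matrix_continuous m n (f : T -> 'M[R]_(m, n)) :
  (forall i j, continuous (fun t => f t i j)) -> continuous f.
Proof.
move=> cf t A [B fB BA].
have : \forall s \near t, forall i j, B i j (f s i j).
  by do 2 apply: filter_forall => ?; exact/cf/fB.
by apply: filterS => s Bs; exact: BA.
Qed.

End RealContinuity.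

(** * Punctured plane, disc and circle *)

Section Disc.
Variable R : realType.
Implicit Types (p q x y z : R * R) (c : R * R -> R * R -> bool).

Definition sqnorm p : R := p.1 ^+ 2 + p.2 ^+ 2.
Definition disc : set (R * R) := [set p | sqnorm p <= 1].
Definition circle : set (R * R) := [set p | sqnorm p = 1].

(** The angular class around [q]: it counts mod 2 the crossings of the horizontal
    ray that goes from [q] to the right. On the half-plane right of [q] it is the
    coboundary of the indicator of the upper side, and elsewhere it is zero. *)
Definition winding q : R * R -> R * R -> bool := fun y z =>
  [&& q.1 < y.1, q.1 < z.1 & (q.2 <= y.2) (+) (q.2 <= z.2)].

Definition box_around q (e : R) : set (R * R) :=
  [set y | `|y.1 - q.1| < e /\ `|y.2 - q.2| < e].

Lemma box_around_nbhs q (e : R) : 0 < e -> nbhs q (box_around q e).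
Proof. by move=> e0; apply/near_pair; exists e. Qed.

Lemma winding_cocycle_at q x A : x != q -> cocycle_at A (winding q) x.
Proof.
move=> xq; apply: (@cocycle_atS _ A setT) => //; have [lt|gt|eq1] := ltgtP x.1 q.1.
- exists (box_around x (q.1 - x.1)); first by apply: box_around_nbhs; rewrite subr_gt0.
  move=> y z; rewrite /box_around /= !ltr_norml => -[/andP[_ h] _] [/andP[_ h'] _] _ _.
  rewrite /winding; have -> : q.1 < x.1 = false by apply/negbTE; rewrite -leNgt ltW.
  by have -> : q.1 < y.1 = false by apply/negbTE; rewrite -leNgt; lra.
- exists (box_around x (x.1 - q.1)); first by apply: box_around_nbhs; rewrite subr_gt0.
  move=> y z; rewrite /box_around /= !ltr_norml => -[/andP[h _] _] [/andP[h' _] _] _ _.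
  rewrite /winding gt; have -> : q.1 < y.1 by lra.
  have -> : q.1 < z.1 by lra.
  by rewrite /=; case: (_ <= x.2) (_ <= y.2) (_ <= z.2) => [] [] [].
- have ne2 : x.2 != q.2.
    by apply: contraNneq xq => eq2; case: x q eq1 eq2 => [? ?] [? ?] /= -> ->.
  exists (box_around x `|x.2 - q.2|).
    by apply: box_around_nbhs; rewrite normr_gt0 subr_eq0.
  have cst y : box_around x `|x.2 - q.2| y -> (q.2 <= y.2) = (q.2 <= x.2).
    move=> [_]; case: (leP q.2 x.2) => h.
      by rewrite [X in _ < X]ger0_norm ?subr_ge0// ltr_norml => /andP[? _]; apply/idP; lra.
    rewrite [X in _ < X]ler0_norm ?subr_le0 ?(ltW h)// ltr_norml => /andP[_ ?].
    by apply/negbTE; rewrite -ltNge; lra.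
  by move=> y z /cst Ey /cst Ez _ _; rewrite /winding Ey Ez addbb !andbF.
Qed.

Lemma winding_cocycle q A : ~ A q -> cocycle A (winding q).
Proof. by move=> nAq x Ax; apply: winding_cocycle_at; apply: contra_notN nAq => /eqP <-. Qed.

Lemma lt_convex_comb (h u v t : R) : h < u -> h < v -> 0 <= t <= 1 ->
  h < (1 - t) * u + t * v.
Proof.
move=> hu hv /andP[t0 t1]; have [->|t0'] := eqVneq t 0.
  by rewrite subr0 mul1r mul0r addr0.
have tp : 0 < t by rewrite lt_neqAle eq_sym t0'.
suff : 0 < (1 - t) * (u - h) + t * (v - h) by lra.
by apply: ltr_wpDl; [apply: mulr_ge0; lra|apply: mulr_gt0; lra].
Qed.

Lemma convex_halfplane (a b h : R) :
  convexly_closed [set p : R * R | h < a * p.1 + b * p.2].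
Proof.
move=> [x1 x2] [y1 y2] t /= hx hy t01; rewrite /GRing.scale /=.
by have := lt_convex_comb hx hy t01; lra.
Qed.

Lemma convex_disc : convexly_closed disc.
Proof.
move=> [x1 x2] [y1 y2] t; rewrite /disc /sqnorm /= => hx hy /andP[t0 t1].
rewrite /GRing.scale /=.
have : 0 <= t * (1 - t) * ((x1 - y1) ^+ 2 + (x2 - y2) ^+ 2).
  by apply: mulr_ge0; [nra|rewrite addr_ge0// sqr_ge0].
have : 0 <= t * (1 - (y1 ^+ 2 + y2 ^+ 2)) by apply: mulr_ge0 => //; lra.
have : 0 <= (1 - t) * (1 - (x1 ^+ 2 + x2 ^+ 2)) by apply: mulr_ge0; lra.
by lra.
Qed.

Lemma convex_box_around q (e : R) : convexly_closed (box_around q e).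
Proof.
have H (u x y t : R) : `|x - u| < e -> `|y - u| < e -> 0 <= t <= 1 ->
    `|(1 - t) * x + t * y - u| < e.
  rewrite !ltr_norml => /andP[x1 x2] /andP[y1 y2] t01.
  have := lt_convex_comb x1 y1 t01.
  have : - e < u - x by lra.
  move=> /lt_convex_comb /(_ (_ : - e < u - y) t01) H.
  have : - e < u - y by lra.
  by move=> /H; lra.
by move=> x y t [? ?] [? ?] t01; split; rewrite /= /GRing.scale /=; exact: H.
Qed.

(** Compare a primitive on the four half-boxes around [q]. It is constant on the
    upper, lower and left ones, with the same value since the left one meets the
    other two; but on the right one it differs from the indicator of the upper
    side by a constant. *)
Lemma winding_not_exact q (e : R) : 0 < e ->
  ~ exact (box_around q e `\` [set q]) (winding q).
Proof.
move=> e0 [g Hg].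
pose half (a b : R) := box_around q e `&`
  [set p : R * R | a * q.1 + b * q.2 < a * p.1 + b * p.2].
have halfS a b : half a b `<=` box_around q e `\` [set q].
  by move=> y [By /= h]; split => // yq; move: h; rewrite yq ltxx.
have chalf a b : conn (half a b).
  apply: conn_convex; apply: convexly_closedI.
    exact: convex_box_around.
  exact: convex_halfplane.
have cst a b h : (forall x y, half a b x -> half a b y ->
      winding q x y = h x (+) h y) ->
    exists d, forall x, half a b x -> g x = h x (+) d.
  move=> H; apply: primitive_conn (chalf a b) _ (primitive_pointwise H).
  exact: primitiveS Hg.
have [d1 D1] : exists d, forall x, half 1 0 x -> g x = (q.2 <= x.2) (+) d.
  apply: cst => x y [_ /= hx] [_ /= hy]; rewrite /winding.
  have -> : q.1 < x.1 by lra.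
  by have -> : q.1 < y.1 by lra.
have [d2 D2] : exists d, forall x, half (-1) 0 x -> g x = false (+) d.
  apply: cst => x y [_ /= hx] [_ /= hy]; rewrite /winding.
  by have -> : q.1 < x.1 = false by apply/negbTE; rewrite -leNgt; lra.
have [d3 D3] : exists d, forall x, half 0 1 x -> g x = false (+) d.
  apply: cst => x y [_ /= hx] [_ /= hy]; rewrite /winding.
  have -> : q.2 <= x.2 by lra.
  have -> : q.2 <= y.2 by lra.
  by rewrite !andbF.
have [d4 D4] : exists d, forall x, half 0 (-1) x -> g x = false (+) d.
  apply: cst => x y [_ /= hx] [_ /= hy]; rewrite /winding.
  have -> : q.2 <= x.2 = false by apply/negbTE; rewrite -ltNge; lra.
  have -> : q.2 <= y.2 = false by apply/negbTE; rewrite -ltNge; lra.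
  by rewrite !andbF.
have corner (u v : R) : `|u| < e -> `|v| < e -> forall a b, 0 < a * u + b * v ->
    half a b (q.1 + u, q.2 + v).
  move=> ue ve a b h; split; last by rewrite /=; lra.
  by split; rewrite /= addrC addKr.
have e2 : `|e / 2| < e by rewrite gtr0_norm; lra.
have e2' : `|- (e / 2)| < e by rewrite normrN.
have q2e : q.2 <= q.2 + e / 2 by lra.
have q2e' : q.2 <= q.2 - e / 2 = false by apply/negbTE; rewrite -ltNge; lra.
have : half 0 1 (q.1 + e / 2, q.2 + e / 2) by apply: corner => //; lra.
move=> /D3; have : half 1 0 (q.1 + e / 2, q.2 + e / 2) by apply: corner => //; lra.
move=> /D1 ->.
have : half 0 (-1) (q.1 + e / 2, q.2 - e / 2) by apply: corner => //; lra.
move=> /D4; have : half 1 0 (q.1 + e / 2, q.2 - e / 2) by apply: corner => //; lra.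
move=> /D1 ->.
have : half 0 1 (q.1 - e / 2, q.2 + e / 2) by apply: corner => //; lra.
move=> /D3; have : half (-1) 0 (q.1 - e / 2, q.2 + e / 2) by apply: corner => //; lra.
move=> /D2 ->.
have : half 0 (-1) (q.1 - e / 2, q.2 - e / 2) by apply: corner => //; lra.
move=> /D4; have : half (-1) 0 (q.1 - e / 2, q.2 - e / 2) by apply: corner => //; lra.
move=> /D2 ->.
rewrite /= q2e q2e'.
by case: d1 d2 d3 d4 {D1 D2 D3 D4} => [] [] [] [].
Qed.

Lemma sqnorm_continuous : continuous sqnorm.
Proof.
by apply: continuousDf; apply: continuous_sqr => p; [exact: cvg_fst|exact: cvg_snd].
Qed.

End Disc.

Section DiscCircle.
Variable R : realType.
Implicit Types (p q x y z : R * R) (c : R * R -> R * R -> bool).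

Lemma convex_segment (a b : R) : convexly_closed [set t : R | a <= t <= b].
Proof.
move=> x y t /= /andP[? ?] /andP[? ?] /andP[? ?]; rewrite /GRing.scale /=.
by apply/andP; split; nra.
Qed.

Lemma convex_ray (h : R) : convexly_closed [set t : R | h < t].
Proof. by move=> x y t /= hx hy t01; exact: lt_convex_comb. Qed.

Definition circle_arc (e : R * R) (h : R) : set (R * R) :=
  @circle R `&` [set p | h < e.1 * p.1 + e.2 * p.2].

(** The two half-circles ([s = 1] and [s = -1]) as graphs over the diameter in
    the direction of the unit vector [e]. *)
Let graph (e : R * R) (s t : R) : R * R :=
  (t * e.1 - s * Num.sqrt (1 - t ^+ 2) * e.2,
   t * e.2 + s * Num.sqrt (1 - t ^+ 2) * e.1).

Let graph_continuous e s : continuous (graph e s).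
Proof.
have cid : continuous (fun t : R => t) by move=> t; exact: cvg_id.
have cst r : continuous (fun _ : R => r : R) by exact: continuous_constant.
have cs : continuous (fun t : R => s * Num.sqrt (1 - t ^+ 2)).
  apply: continuousMf => //; apply: continuous_sqrt; apply: continuousDf => //.
  by move=> t; apply: cvgN; exact: continuous_sqr.
have cse r : continuous (fun t : R => s * Num.sqrt (1 - t ^+ 2) * r) by exact: continuousMc.
apply: pair_continuous; apply: continuousDf => //; try exact: continuousMc.
by move=> t; apply: cvgN; exact: cse.
Qed.

Let graph_circle e s t : sqnorm e = 1 -> s ^+ 2 = 1 -> -1 <= t <= 1 ->
  circle (graph e s t) /\ e.1 * (graph e s t).1 + e.2 * (graph e s t).2 = t.
Proof.
rewrite /circle /sqnorm /= => e1 s1 /andP[t0 t1].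
have := sqr_sqrtr (_ : 0 <= 1 - t ^+ 2); set r := Num.sqrt _ => /(_ _) rE.
have {}rE : r ^+ 2 = 1 - t ^+ 2 by apply: rE; nra.
split.
  transitivity ((t ^+ 2 + s ^+ 2 * r ^+ 2) * (e.1 ^+ 2 + e.2 ^+ 2)); first by ring.
  by rewrite e1 s1 rE; ring.
transitivity (t * (e.1 ^+ 2 + e.2 ^+ 2)); first by ring.
by rewrite e1 mulr1.
Qed.

Let circle_graph e p : sqnorm e = 1 -> circle p ->
  let t := e.1 * p.1 + e.2 * p.2 in
  -1 <= t <= 1 /\ (p = graph e 1 t \/ p = graph e (-1) t).
Proof.
move=> e1 p1 t; rewrite /circle /sqnorm /= in e1 p1.
pose s := e.1 * p.2 - e.2 * p.1.
have ts : t ^+ 2 + s ^+ 2 = 1.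
  transitivity ((e.1 ^+ 2 + e.2 ^+ 2) * (p.1 ^+ 2 + p.2 ^+ 2)); first by rewrite /t /s; ring.
  by rewrite e1 p1 mulr1.
have pE1 : p.1 = t * e.1 - s * e.2.
  transitivity (p.1 * (e.1 ^+ 2 + e.2 ^+ 2)); first by rewrite e1 mulr1.
  by rewrite /t /s; ring.
have pE2 : p.2 = t * e.2 + s * e.1.
  transitivity (p.2 * (e.1 ^+ 2 + e.2 ^+ 2)); first by rewrite e1 mulr1.
  by rewrite /t /s; ring.
have sE : Num.sqrt (1 - t ^+ 2) = `|s| by rewrite -ts addrC addKr sqrtr_sqr.
split; first by have := sqr_ge0 s; move: ts => /eqP; rewrite -subr_eq0 => /eqP ts ?; apply/andP; split; nra.
rewrite /graph sE; case: (leP 0 s) => s0; [left|right].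
  by rewrite ger0_norm// mul1r -pE1 -pE2; case: p {p1 t s pE1 pE2 ts sE s0}.
by rewrite ltr0_norm// mulrNN mul1r -pE1 -pE2; case: p {p1 t s pE1 pE2 ts sE s0}.
Qed.

Lemma conn_circle_arc e h : sqnorm e = 1 -> conn (circle_arc e h).
Proof.
move=> e1; pose J : set R := [set t | -1 <= t <= 1] `&` [set t | h < t].
have cJ s : conn (graph e s @` J).
  apply: conn_image; last by apply: continuous_cont_on => t; exact: graph_continuous.
  by apply: conn_convex; apply: convexly_closedI; [exact: convex_segment|exact: convex_ray].
have arcE : circle_arc e h = (graph e 1 @` J) `|` (graph e (-1) @` J).
  apply/seteqP; split=> [p [Cp hp]|p].
    have [t01 [pE|pE]] := circle_graph e1 Cp; [left|right];
    by eexists; last exact: esym pE.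
  have s1 : 1 ^+ 2 = 1 :> R by rewrite expr1n.
  have sN : (-1) ^+ 2 = 1 :> R by rewrite sqrrN.
  by case=> -[t [t01 ht] <-]; [have [H1 H2] := graph_circle e1 s1 t01|
    have [H1 H2] := graph_circle e1 sN t01]; split => //; rewrite /= H2.
have [h1|h1] := ltP h 1; last first.
  apply: conn_joined => x y [Cx hx]; exfalso.
  have [/andP[_ t1] _] := circle_graph e1 Cx.
  by have := lt_le_trans hx t1; rewrite ltNge h1.
rewrite arcE; apply: (connU (x := e)) => //; exists 1; rewrite /J /setI /= ?lexx ?andbT;
  rewrite /graph ?expr1n ?subrr ?sqrtr0 ?mulr0 ?mul0r ?mul1r ?subr0 ?addr0 -?surjective_pairing//;
  by split => //; lra.
Qed.

Lemma exact_half_circle (s : R) c : s ^+ 2 = 1 -> cocycle (@circle R) c ->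
  exact (@circle R `&` [set p | 0 <= s * p.2]) c.
Proof.
move=> s1 cc; have e1 : sqnorm ((1 : R), (0 : R)) = 1.
  by rewrite /sqnorm /= expr1n expr0n addr0.
pose I : set R := [set t | -1 <= t <= 1].
have cf : continuous (graph (1, 0) s) by exact: graph_continuous.
apply: (@exact_section _ _ I _ (graph (1, 0) s) (fun p => p.1)).
- by apply: continuous_cont_on => p; exact: cvg_fst.
- move=> y [Cy _]; have [] := circle_graph e1 Cy.
  by rewrite /= mul1r mul0r addr0.
- move=> y [Cy /= sy]; rewrite /graph /= !mulr0 subr0 !mulr1 add0r.
  case: y Cy sy => y1 y2; rewrite /circle /sqnorm /= => Cy sy; congr pair.
  have -> : 1 - y1 ^+ 2 = (s * y2) ^+ 2 by rewrite exprMn s1 mul1r -Cy addrAC subrr add0r.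
  by rewrite sqrtr_sqr ger0_norm// mulrA -expr2 s1 mul1r.
- apply: exact_convex; first exact: convex_segment.
  apply: cocycle_pullback cc; first by apply: continuous_cont_on => t; exact: cf.
  by move=> t It; exact: (graph_circle e1 s1 It).1.
Qed.

Lemma circle_two_classes c d : cocycle (@circle R) c -> cocycle (@circle R) d ->
  [\/ exact (@circle R) c, exact (@circle R) d | exact (@circle R) (addc c d)].
Proof.
move=> cc cd; pose H (s : R) := @circle R `&` [set p | 0 <= s * p.2].
have sN : (-1) ^+ 2 = 1 :> R by rewrite sqrrN expr1n.
apply: (@two_pieces _ _ (H 1) (H (-1)) _ [set (1, 0)] [set (-1, 0)]).
- move=> x Cx; have := closed_halves2 0 Cx; apply: filterS => y h Cy.
  move: (h Cy); rewrite /H /setI /=.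
  by move=> [[[? ?] [? ?]]|[[? ?] [? ?]]]; [right|left]; do !split => //; lra.
- exact: conn1.
- exact: conn1.
- apply/seteqP; split=> [[p1 p2] [[Cp /= h1] [_ /= h2]]|p].
    have p20 : p2 = 0 by lra.
    move: Cp; rewrite /circle /sqnorm /= p20 expr0n addr0 => /eqP.
    rewrite sqrf_eq1 => /orP[]/eqP ->; [left|right] => //.
  by case=> ->; rewrite /H /circle /sqnorm /setI /= ?sqrrN expr1n expr0n addr0 !mulr0 lexx.
all: by apply: exact_half_circle => //; rewrite expr1n.
Qed.

(** Cover the punctured disc by its four intersections with the open half-planes
    bounded by the horizontal and vertical lines through [q]. These are convex, they
    cut the circle in arcs, and each nonempty overlap is a convex set that reaches
    the circle; so triviality on the circle transfers. *)
Lemma exact_punctured_disc q c : sqnorm q < 1 ->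
  cocycle (@disc R `\` [set q]) c -> exact (@circle R) c ->
  exact (@disc R `\` [set q]) c.
Proof.
move=> q1 cc exC.
pose sg (b : bool) : R := if b then 1 else -1.
pose e (i : bool * bool) : R * R := if i.1 then (sg i.2, 0) else (0, sg i.2).
pose H i : set (R * R) := [set p | (e i).1 * q.1 + (e i).2 * q.2 < (e i).1 * p.1 + (e i).2 * p.2].
have sg2 b : sg b ^+ 2 = 1 by case: b; rewrite /sg ?sqrrN expr1n.
have e1 i : sqnorm (e i) = 1.
  by case: i => [[] b]; rewrite /sqnorm /e /= expr0n sg2 ?addr0 ?add0r.
have HS i : @disc R `&` H i `<=` @disc R `\` [set q].
  by move=> p [Dp Hp]; split => // pq; move: Hp; rewrite pq /H /= ltxx.
have cvH i : convexly_closed (@disc R `&` H i).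
  by apply: convexly_closedI; [exact: convex_disc|exact: convex_halfplane].
apply: (@exact_transfer _ _ _ (@circle R) (fun i => @disc R `&` H i)
  (fun i => circle_arc (e i) ((e i).1 * q.1 + (e i).2 * q.2))) => //.
- move=> x [Dx xq].
  have [i Hx] : exists i, H i x.
    rewrite /H /=; have [lt|gt|eq1] := ltgtP x.1 q.1.
    + by exists (true, false); rewrite /e /sg /=; lra.
    + by exists (true, true); rewrite /e /sg /=; lra.
    have [lt|gt|eq2] := ltgtP x.2 q.2.
    + by exists (false, false); rewrite /e /sg /=; lra.
    + by exists (false, true); rewrite /e /sg /=; lra.
    by case: xq; case: x q eq1 eq2 {Dx q1 cc H HS cvH} => [? ?] [? ?] /= -> ->.
  have : \forall y \near x, H i y.
    apply/near_pair; rewrite /H /= in Hx *.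
    exists (((e i).1 * x.1 + (e i).2 * x.2) - ((e i).1 * q.1 + (e i).2 * q.2)).
      by rewrite subr_gt0.
    move=> y; rewrite !ltr_norml => /andP[l1 l2] /andP[l3 l4].
    by case: i Hx l1 l2 l3 l4 => [[] []]; rewrite /e /sg /=; lra.
  by apply: filterS => y Hy [Dy _]; exists i.
- by move=> i; apply: exact_convex; [exact: cvH|exact: cocycleS cc].
- move=> i p [Cp Hp]; split => //; split => //.
  by move: Cp; rewrite /circle /disc /= => ->.
- by move=> i; exact: conn_circle_arc.
move=> i j x ij [Dx Hi] [_ Hj]; exists ((@disc R `&` H i) `&` (@disc R `&` H j)); split => //.
  by apply: conn_convex; apply: convexly_closedI.
pose u := (e i).1 + (e j).1; pose v := (e i).2 + (e j).2.
have [u1 [v1 pos]] : u ^+ 2 = 1 /\ v ^+ 2 = 1 /\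
    ((e i).1 * u + (e i).2 * v = 1 /\ (e j).1 * u + (e j).2 * v = 1).
  rewrite /u /v; move: i j ij Hi Hj {u v}; rewrite /H /e /sg /=.
  by case=> [[] []] [[] []] //=; rewrite ?mul1r ?mul0r ?mulN1r => _ h1 h2; try lra;
    do !split; ring.
pose b := u * q.1 + v * q.2.
pose D := b ^+ 2 + 2 * (1 - sqnorm q).
have D0 : 0 <= D by rewrite /D addr_ge0 ?sqr_ge0// mulr_ge0//; lra.
pose t := (Num.sqrt D - b) / 2.
have tE : 2 * t ^+ 2 + 2 * t * b + sqnorm q = 1.
  have := sqr_sqrtr D0; rewrite {2}/D => rE.
  have -> : 2 * t ^+ 2 + 2 * t * b = (Num.sqrt D ^+ 2 - b ^+ 2) / 2 by rewrite /t; field.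
  by rewrite rE; field.
have t0 : 0 < t.
  rewrite divr_gt0// subr_gt0; apply: le_lt_trans (ler_norm b) _.
  by rewrite -sqrtr_sqr ltr_sqrt /D ?ltrDl; [|apply: ltr_wpDl; rewrite ?sqr_ge0//]; rewrite mulr_gt0// subr_gt0.
have Hy k : (e k).1 * u + (e k).2 * v = 1 -> H k (q.1 + t * u, q.2 + t * v).
  move=> ek; rewrite /H /= -subr_gt0.
  have -> : (e k).1 * (q.1 + t * u) + (e k).2 * (q.2 + t * v) -
     ((e k).1 * q.1 + (e k).2 * q.2) = t * ((e k).1 * u + (e k).2 * v) by ring.
  by rewrite ek mulr1.
have Cy : circle (q.1 + t * u, q.2 + t * v).
  rewrite /circle /sqnorm /= -{1}tE /sqnorm /b.
  have -> : (q.1 + t * u) ^+ 2 + (q.2 + t * v) ^+ 2 =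
    t ^+ 2 * (u ^+ 2 + v ^+ 2) + 2 * t * (u * q.1 + v * q.2) + (q.1 ^+ 2 + q.2 ^+ 2) by ring.
  by rewrite u1 v1; ring.
have Dy : disc (q.1 + t * u, q.2 + t * v) by rewrite /disc /= Cy.
exists (q.1 + t * u, q.2 + t * v); case: pos => pi pj.
by split; [split; split => //; exact: Hy|split => //; exact: (Hy i)|split => //; exact: (Hy j)].
Qed.

Lemma open_disc_box q : sqnorm q < 1 -> exists2 e : R, 0 < e & box_around q e `<=` @disc R.
Proof.
move=> q1; have : \forall p \near q, sqnorm p < 1.
  exact: cvgr_lt (@sqnorm_continuous R q) _ q1.
move=> /(@near_pair R)[e e0 He]; exists e => // p [? ?]; exact/ltW/He.
Qed.

Lemma winding_circle_not_exact q : sqnorm q < 1 -> ~ exact (@circle R) (winding q).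
Proof.
move=> q1 exC; have [e e0 He] := open_disc_box q1.
apply: (winding_not_exact e0 (q := q)); apply: (@exactS _ _ (@disc R `\` [set q])).
  by move=> p [/He].
by apply: exact_punctured_disc => //; apply: winding_cocycle => -[_]; apply.
Qed.

(** Both classes are nontrivial on the circle, whose cohomology has dimension
    at most one. *)
Lemma winding_circle_homologous q q' : sqnorm q < 1 -> sqnorm q' < 1 ->
  exact (@circle R) (addc (winding q) (winding q')).
Proof.
have cw p : sqnorm p < 1 -> cocycle (@circle R) (winding p).
  by move=> p1; apply: winding_cocycle => Cp; move: p1; rewrite Cp ltxx.
move=> q1 q1'; have [||//] := circle_two_classes (cw q q1) (cw q' q1').
  by move=> /(@winding_circle_not_exact q q1).
by move=> /(@winding_circle_not_exact q' q1').
Qed.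

End DiscCircle.

(** * The pinched torus as a doubled disc *)

Section Torus.
Variables (R : realType) (a b : R).
Hypotheses (b_gt0 : 0 < b) (b_lt_a : b < a).

Local Notation space := 'rV[R]_3.
Local Notation P := (pinched_torus a b).
Local Notation D := (@disc R).

Definition point3 (x y z : R) : space := \row_(i < 3) [:: x; y; z]`_i.

Definition sgn (k : bool) : R := if k then 1 else -1.

Lemma sgn2 k : sgn k ^+ 2 = 1.
Proof. by case: k; rewrite /sgn ?sqrrN expr1n. Qed.

(** The point of the half [k] of the torus over a point [d] of the disc. In terms
    of the angles, [d] has polar angle [v] and radius [|cos (u / 2)|], the factor
    [2 * sqnorm d - 1] is [cos u], and the product of square roots is [|sin u|].
    The polar angle is shifted by [pi] on the lower half, where [cos (u / 2)] is
    negative. *)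
Definition sheet (k : bool) (d : R * R) : space :=
  let rho := a + b * d.1 in let r2 := sqnorm d in
  point3 (rho * (2 * r2 - 1))
    (sgn k * (rho * (2 * Num.sqrt r2 * Num.sqrt (1 - r2))))
    (b * d.2).

(** The common inverse of the two sheets: as [a + b * d.1] is positive, it is the
    distance to the vertical axis. *)
Definition fold (y : space) : R * R :=
  ((Num.sqrt (y 0 0 ^+ 2 + y 0 1 ^+ 2) - a) / b, y 0 2%:R / b).

Definition upper (y : space) : bool := 0 <= y 0 1.

Lemma point3E x y z :
  (point3 x y z 0 0 = x) * (point3 x y z 0 1 = y) * (point3 x y z 0 2%:R = z).
Proof. by rewrite /point3 !mxE. Qed.

Lemma sqnorm_ge0 (d : R * R) : 0 <= sqnorm d.
Proof. by rewrite addr_ge0 ?sqr_ge0. Qed.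

Lemma rho_gt0 d : D d -> 0 < a + b * d.1.
Proof.
rewrite /disc /sqnorm /= => Dd.
have : -1 <= d.1 by have := sqr_ge0 d.2; nra.
move=> d1; have : 0 <= b * (1 + d.1) by rewrite mulr_ge0 ?(ltW b_gt0)//; lra.
by move: b_lt_a; rewrite mulrDr mulr1; lra.
Qed.

Lemma foldK k d : D d -> fold (sheet k d) = d.
Proof.
move=> Dd; have rho := rho_gt0 Dd; rewrite /fold /sheet !point3E.
have s2 := sgn2 k.
have r0 := sqnorm_ge0 d.
have r1 : 0 <= 1 - sqnorm d by rewrite subr_ge0.
rewrite (_ : _ ^+ 2 + _ ^+ 2 = (a + b * d.1) ^+ 2); last first.
  rewrite !exprMn s2 !sqr_sqrtr// mul1r; ring.
rewrite sqrtr_sqr ger0_norm ?(ltW rho)//.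
have b0 : b != 0 by rewrite gt_eqF.
by rewrite addrAC subrr add0r mulrAC divff// mul1r mulrAC divff// mul1r -surjective_pairing.
Qed.

Lemma angle_exists (c s : R) : c ^+ 2 + s ^+ 2 = 1 ->
  exists2 v, 0 <= v <= 2 * pi & cos v = c /\ sin v = s.
Proof.
move=> cs; have c1 : -1 <= c <= 1.
  by have := sqr_ge0 s; move=> ?; apply/andP; split; nra.
have sE : Num.sqrt (1 - c ^+ 2) = `|s| by rewrite -cs addrAC subrr add0r sqrtr_sqr.
have a0 := acos_ge0 c1; have a1 := acos_lepi c1.
have pi0 := @pi_gt0 R.
have [s0|s0] := leP 0 s.
  exists (acos c); first by apply/andP; split; lra.
  by rewrite sin_acos// sE ger0_norm// acosK// in_itv /=.
exists (2 * pi - acos c); first by apply/andP; split; lra.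
have -> : 2 * pi = pi *+ 2 :> R by rewrite mulr_natl.
by rewrite cosB sinB cos2pi sin2pi sin_acos// sE ltr0_norm// acosK ?in_itv//=; split; ring.
Qed.

Lemma sheet_in k d : D d -> P (sheet k d).
Proof.
move=> Dd; have r0 := sqnorm_ge0 d; have r1 : 0 <= 1 - sqnorm d by rewrite subr_ge0.
have s2 := sgn2 k; set s := sgn k in s2.
pose r := s * Num.sqrt (sqnorm d).
have r2 : r ^+ 2 = sqnorm d by rewrite exprMn s2 mul1r sqr_sqrtr.
have r11 : -1 <= r <= 1 by rewrite /disc /= in Dd; apply/andP; split; nra.
pose u := acos r *+ 2.
have u2 : u / 2 = acos r by rewrite /u; field.
have [v v02 [cv sv]] : exists2 v, 0 <= v <= 2 * pi &
    cos v * r = d.1 /\ sin v * r = d.2.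
  have [r00|rn0] := eqVneq r 0.
    exists 0; first by rewrite lexx mulr_ge0// pi_ge0.
    have d1 := sqr_ge0 d.1; have d2 := sqr_ge0 d.2.
    move: r2; rewrite r00 expr0n /sqnorm /= => /esym/eqP.
    rewrite paddr_eq0// !sqrf_eq0 => /andP[/eqP -> /eqP ->].
    by rewrite !mulr0.
  have [|v v0 [cv sv]] := @angle_exists (d.1 / r) (d.2 / r).
    by rewrite !expr_div_n -mulrDl -/(sqnorm d) -r2 divff// sqrf_eq0.
  by exists v => //; rewrite cv sv !divfK.
have a0 := acos_ge0 r11; have a1 := acos_lepi r11.
exists u; first by rewrite /= /u -mulr_natl; apply/andP; split; lra.
exists v => //; rewrite /pinched_torus_param u2.
have cr : cos (acos r) = r by rewrite acosK ?in_itv.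
have sr : sin (acos r) = Num.sqrt (1 - sqnorm d) by rewrite sin_acos// r2.
rewrite /u cos_mulr2n sin_mulr2n cr sr r2.
rewrite /sheet /point3 -/s /= -cv -sv.
have rs : Num.sqrt (sqnorm d) = s * r by rewrite /r mulrA -expr2 s2 mul1r.
rewrite rs; apply/rowP => i; rewrite !mxE.
congr nth; congr [:: _; _; _].
- by rewrite mulr2n; ring.
- transitivity (s ^+ 2 * ((a + b * (cos v * r)) * (2 * r * Num.sqrt (1 - sqnorm d)))).
    by rewrite s2 -mulr_natl; ring.
  by ring.
- by ring.
Qed.

Lemma in_sheet y : P y -> exists k, exists2 d, D d & y = sheet k d.
Proof.
move=> [u /andP[u0 u1] [v _ <-]]; rewrite /pinched_torus_param.
set c := cos (u / 2); set s := sin (u / 2).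
have cs : c ^+ 2 + s ^+ 2 = 1 by rewrite cos2Dsin2.
have s0 : 0 <= s by apply: sin_ge0_pi; apply/andP; split; lra.
have vv : cos v ^+ 2 + sin v ^+ 2 = 1 by rewrite cos2Dsin2.
have u2 : u = (u / 2) *+ 2 by rewrite -mulr_natr divfK.
have cu : cos u = 2 * c ^+ 2 - 1 by rewrite u2 cos_mulr2n mulr_natl.
have su : sin u = 2 * (c * s) by rewrite u2 sin_mulr2n mulr_natl.
have r2 : sqnorm (cos v * c, sin v * c) = c ^+ 2.
  by rewrite /sqnorm /= !exprMn -mulrDl vv mul1r.
exists (0 <= c), (cos v * c, sin v * c).
  by rewrite /disc /= r2; have := sqr_ge0 s; lra.
have cE : sgn (0 <= c) * Num.sqrt (c ^+ 2) = c.
  rewrite sqrtr_sqr /sgn; case: leP => c0; first by rewrite mul1r ger0_norm.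
  by rewrite mulN1r ltr0_norm// opprK.
have sE : Num.sqrt (1 - c ^+ 2) = s by rewrite -cs addrAC subrr add0r sqrtr_sqr ger0_norm.
rewrite /sheet /point3 r2 cu su /= sE; apply/rowP => i; rewrite !mxE.
congr nth; congr [:: _; _; _].
- by ring.
- transitivity ((a + b * (cos v * c)) * (2 * (sgn (0 <= c) * Num.sqrt (c ^+ 2)) * s)).
    by rewrite cE; ring.
  by ring.
- by rewrite mulrA.
Qed.

Lemma upper_sheetE k d : (sheet k d) 0 1 =
  sgn k * ((a + b * d.1) * (2 * Num.sqrt (sqnorm d) * Num.sqrt (1 - sqnorm d))).
Proof. by rewrite /sheet point3E. Qed.

Lemma sheet_height_ge0 k d : D d -> 0 <= sgn k * (sheet k d) 0 1.
Proof.
move=> Dd; rewrite upper_sheetE mulrA -expr2 sgn2 mul1r.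
by rewrite !mulr_ge0 ?sqrtr_ge0// ltW// rho_gt0.
Qed.

(** The two sheets meet where the second coordinate vanishes: over the boundary
    circle of the disc, and over its centre, which gives the pinch point. *)
Lemma sheet_height_eq0 k d : D d ->
  (sheet k d) 0 1 = 0 -> sqnorm d = 1 \/ d = (0, 0).
Proof.
move=> Dd /eqP; have rho := rho_gt0 Dd.
have sk : sgn k != 0 by case: k; rewrite /sgn ?oppr_eq0 oner_eq0.
rewrite upper_sheetE !mulf_eq0 (negbTE sk) (gt_eqF rho) pnatr_eq0 /=.
rewrite !sqrtr_eq0 => /orP[]h; [right|left].
  have := sqr_ge0 d.1; have := sqr_ge0 d.2; rewrite /sqnorm in h => h1 h2.
  have /eqP : d.1 ^+ 2 = 0 by lra.
  have /eqP : d.2 ^+ 2 = 0 by lra.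
  by rewrite !sqrf_eq0 => /eqP d2 /eqP d1; case: d d1 d2 {Dd rho h h1 h2} => /= ? ? -> ->.
by apply/eqP; rewrite eq_le; apply/andP; split => //; lra.
Qed.

Lemma sheet_seam k d : sqnorm d = 1 \/ d = (0, 0) -> sheet k d = sheet true d.
Proof.
move=> h; rewrite /sheet; congr point3.
by case: h => [->|->]; rewrite ?subrr /sqnorm /= ?expr0n ?addr0 /= sqrtr0 ?mulr0 ?mul0r ?mulr0.
Qed.

Definition half_torus (k : bool) : set space := P `&` [set y | 0 <= sgn k * y 0 1].

Lemma sheet_half k d : D d -> half_torus k (sheet k d).
Proof. by move=> Dd; split; [exact: sheet_in|exact: sheet_height_ge0]. Qed.

Lemma half_torusP k y : half_torus k y -> D (fold y) /\ sheet k (fold y) = y.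
Proof.
move=> [/in_sheet[l [d Dd ->]] /= h]; rewrite foldK//; split=> //.
have [->//|kl] := eqVneq k l.
have seam : (sheet l d) 0 1 = 0.
  have := sheet_height_ge0 l Dd; move: h kl; rewrite /sgn.
  by case: k l => [] []//=; lra.
have := sheet_height_eq0 Dd seam => sm.
by rewrite !(sheet_seam _ sm).
Qed.

Lemma fold_disc y : P y -> D (fold y).
Proof. by move=> /in_sheet[k [d Dd ->]]; rewrite foldK. Qed.

Lemma half_torus_cover y : P y -> half_torus (upper y) y.
Proof.
move=> Py; split => //; rewrite /upper /sgn /=.
by case: (leP 0 (y 0 1)) => h; rewrite ?mul1r// mulN1r oppr_ge0 ltW.
Qed.

Lemma sheet_upper y : P y -> sheet (upper y) (fold y) = y.
Proof. by move=> /half_torus_cover /half_torusP[]. Qed.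

Lemma fold_continuous : continuous fold.
Proof.
have cc i : continuous (fun y : space => y 0 i) by exact: coord_continuous.
apply: pair_continuous.
  by apply: continuousMc; apply: continuousBc; apply: continuous_sqrt;
    apply: continuousDf; apply: continuous_sqr.
exact: continuousMc.
Qed.

Lemma sheet_continuous k : continuous (sheet k).
Proof.
apply: matrix_continuous => i j.
have c1 : continuous (fun d : R * R => d.1) by move=> d; exact: cvg_fst.
have c2 : continuous (fun d : R * R => d.2) by move=> d; exact: cvg_snd.
have cs := @sqnorm_continuous R.
have cst r : continuous (fun _ : R * R => r : R) by exact: continuous_constant.
have cr : continuous (fun d : R * R => a + b * d.1).
  by apply: continuousDf => //; exact: continuousMf.
have -> : (fun d => sheet k d i j) = (fun d =>
    [:: (a + b * d.1) * (2 * sqnorm d - 1);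
        sgn k * ((a + b * d.1) * (2 * Num.sqrt (sqnorm d) * Num.sqrt (1 - sqnorm d)));
        b * d.2]`_j) by apply/funext => d; rewrite /sheet /point3 mxE.
case: j => -[|[|[|//]]] _ /=.
- by apply: continuousMf => //; apply: continuousBc; apply: continuousMf.
- apply: continuousMf => //; apply: continuousMf => //; apply: continuousMf.
    by apply: continuousMf => //; exact: continuous_sqrt.
  apply: continuous_sqrt; apply: continuousDf => // d.
  by apply: cvgN; exact: cs.
- exact: continuousMf.
Qed.



(** * Classes on the pinched torus: gluing and residues *)

Lemma upper_sheet k d : (sheet k d) 0 1 != 0 -> D d -> upper (sheet k d) = k.
Proof.
move=> ne Dd; have := sheet_height_ge0 k Dd; rewrite /upper /sgn.
case: k ne => ne; rewrite ?mul1r// mulN1r oppr_ge0 => h.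
by apply/negbTE; rewrite -ltNge lt_neqAle ne.
Qed.

Lemma near_upper (y : space) : y 0 1 != 0 -> \forall z \near y, upper z = upper y.
Proof.
move=> ne; have cc : continuous (fun y : space => y 0 1) by exact: coord_continuous.
rewrite /upper; case: (leP 0 (y 0 1)) => h.
  have pos : 0 < y 0 1 by rewrite lt_neqAle eq_sym ne.
  by apply: filterS (cvgr_gt _ (cc y) _ pos) => z /ltW.
by apply: filterS (cvgr_lt _ (cc y) _ h) => z zlt; apply/negbTE; rewrite -ltNge.
Qed.

Lemma fold_regular y : P y -> y 0 1 != 0 -> 0 < sqnorm (fold y) < 1.
Proof.
move=> Py ne; have Dd := fold_disc Py; have yE := sheet_upper Py.
have r0 := sqnorm_ge0 (fold y).
apply/andP; split; rewrite lt_neqAle ?r0 ?andbT.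
  apply: contra_neq ne => r00; rewrite -yE upper_sheetE -r00 sqrtr0.
  by rewrite !(mulr0, mul0r).
rewrite [X in _ && X]Dd andbT; apply: contra_neq ne => r1; rewrite -yE upper_sheetE r1.
by rewrite subrr sqrtr0 !mulr0.
Qed.

Lemma seam_fold y : P y -> y 0 1 = 0 -> sqnorm (fold y) = 1 \/ fold y = (0, 0).
Proof.
move=> Py y0; apply: (@sheet_height_eq0 (upper y)); first exact: fold_disc.
by rewrite sheet_upper.
Qed.

(** A retraction onto the seam, that is the circle and the centre, which is
    continuous near the seam. The jump at radius one half does no harm, since only
    points close to the seam are retracted. *)
Definition radial (d : R * R) : R * R :=
  if sqnorm d < 4^-1 then (0, 0)
  else (d.1 / Num.sqrt (sqnorm d), d.2 / Num.sqrt (sqnorm d)).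

Lemma radial_circle d : 4^-1 <= sqnorm d -> sqnorm (radial d) = 1.
Proof.
move=> h; rewrite /radial ltNge h /= {1}/sqnorm /= !expr_div_n -mulrDl -/(sqnorm d).
by rewrite sqr_sqrtr ?sqnorm_ge0// divff// gt_eqF//; apply: lt_le_trans h; rewrite invr_gt0.
Qed.

Lemma radial_disc d : D (radial d).
Proof.
rewrite /disc /=; have [h|h] := ltP (sqnorm d) 4^-1.
  by rewrite /radial h /sqnorm /= expr0n addr0 ler01.
by rewrite radial_circle.
Qed.

Lemma radial_near x U : sqnorm x = 1 \/ x = (0, 0) -> nbhs x U ->
  \forall d \near x, U (radial d) /\
    (sqnorm x = 1 /\ sqnorm (radial d) = 1 \/ radial d = x).
Proof.
move=> [x1|x0] Ux.
  have big : \forall d \near x, 4^-1 < sqnorm d.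
    apply: (cvgr_gt _ (@sqnorm_continuous R x)); rewrite x1 invf_lt1// ltr1n//.
  have cf : {for x, continuous (fun d : R * R =>
      (d.1 / Num.sqrt (sqnorm d), d.2 / Num.sqrt (sqnorm d)))}.
    have ci : (Num.sqrt (sqnorm d))^-1 @[d --> x] --> (Num.sqrt (sqnorm x))^-1.
      apply: cvgV; first by rewrite x1 sqrtr1 oner_eq0.
      by apply: continuous_sqrt; exact: sqnorm_continuous.
    have c1 : d.1 / Num.sqrt (sqnorm d) @[d --> x] --> x.1 / Num.sqrt (sqnorm x).
      by apply: cvgM => //; exact: cvg_fst.
    have c2 : d.2 / Num.sqrt (sqnorm d) @[d --> x] --> x.2 / Num.sqrt (sqnorm x).
      by apply: cvgM => //; exact: cvg_snd.
    exact: (cvg_pair c1 c2).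
  have Ux' : nbhs (x.1 / Num.sqrt (sqnorm x), x.2 / Num.sqrt (sqnorm x)) U.
    by rewrite x1 sqrtr1 !divr1 -surjective_pairing.
  apply: filterS2 big (cf _ Ux') => d bd Ud.
  split; last by left; split => //; apply: radial_circle; rewrite ltW.
  by rewrite /radial ltNge (ltW bd).
have small : \forall d \near x, sqnorm d < 4^-1.
  apply: (cvgr_lt _ (@sqnorm_continuous R x)).
  by rewrite x0 /sqnorm /= expr0n addr0 invr_gt0.
apply: filterS small => d sd; rewrite /radial sd x0; split; last by right.
by rewrite -x0; exact: nbhs_singleton.
Qed.

(** To compare points of different halves, pass through the seam, where the classes
    [u true] and [u false] are assumed to agree. *)
Definition glue (u : bool -> R * R -> R * R -> bool) : space -> space -> bool :=
  fun y z => let d := fold y in let e := fold z in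
  if upper y == upper z then u (upper y) d e
  else u (upper y) d (radial d) (+) u true (radial d) (radial e) (+)
       u (upper z) (radial e) e.

Lemma glue_regular u y : P y -> y 0 1 != 0 ->
  cocycle_at D (u (upper y)) (fold y) -> cocycle_at P (glue u) y.
Proof.
move=> Py ne cu.
have [U Uy HU] := @cocycle_at_pullback _ _ P D fold _ y
  (continuous_cont_on fold_continuous) fold_disc Py cu.
exists (U `&` [set z | upper z = upper y]); first by apply: filterI => //; exact: near_upper.
by move=> z w [Uz Ez] [Uw Ew] Pz Pw; rewrite /glue Ez Ew eqxx; exact: HU.
Qed.

(** Near a point [x] of the seam all terms can be expanded in values at [x]; those
    at the retracted points cancel because the two classes agree on the seam. *)
Lemma glue_seam u y : P y -> y 0 1 = 0 ->
  (forall k, cocycle_at D (u k) (fold y)) ->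
  (\forall d \near fold y, sqnorm (fold y) = 1 -> sqnorm d = 1 ->
     u true (fold y) d = u false (fold y) d) ->
  cocycle_at P (glue u) y.
Proof.
move=> Py y0 cu agree; set x := fold y in cu agree *.
have Dx : D x by exact: fold_disc.
have seam : sqnorm x = 1 \/ x = (0, 0) by exact: seam_fold.
have [U1 U1x H1] := cu true; have [U2 U2x H2] := cu false.
pose U := U1 `&` U2 `&` [set d | sqnorm x = 1 -> sqnorm d = 1 -> u true x d = u false x d].
have Ux : nbhs x U by do 2 apply: filterI => //.
have H k d e : U d -> U e -> D d -> D e -> u k d e = u k x d (+) u k x e.
  by move=> [[? ?] _] [[? ?] _] Dd De; case: k; [apply: H1|apply: H2].
have E d k l : U d -> (sqnorm x = 1 /\ sqnorm d = 1 \/ d = x) -> u k x d = u l x d.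
  move=> [_ Ud] [[x1 d1]|->]; last by rewrite !(cocycle_at_refl (cu _) Dx).
  by have := Ud x1 d1; case: k l => [] [].
have nf : \forall z \near y, U (fold z) /\ (U (radial (fold z)) /\
    (sqnorm x = 1 /\ sqnorm (radial (fold z)) = 1 \/ radial (fold z) = x)).
  apply: (@fold_continuous y [set d | U d /\ (U (radial d) /\
    (sqnorm x = 1 /\ sqnorm (radial d) = 1 \/ radial d = x))]).
  by apply: filterI => //; exact: radial_near.
pose F z := u (upper z) x (fold z).
suff H3 z w : U (fold z) /\ (U (radial (fold z)) /\
    (sqnorm x = 1 /\ sqnorm (radial (fold z)) = 1 \/ radial (fold z) = x)) ->
    U (fold w) /\ (U (radial (fold w)) /\
    (sqnorm x = 1 /\ sqnorm (radial (fold w)) = 1 \/ radial (fold w) = x)) ->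
    P z -> P w -> glue u z w = F z (+) F w.
  have Yy := nbhs_singleton nf.
  exists [set z | U (fold z) /\ (U (radial (fold z)) /\
    (sqnorm x = 1 /\ sqnorm (radial (fold z)) = 1 \/ radial (fold z) = x))]; first exact: nf.
  move=> z w Zz Ww Pz Pw; rewrite (H3 z w)// (H3 y z)// (H3 y w)//.
  by case: (F y) (F z) (F w) => [] [] [].
move=> [Uz [Uz' Ez]] [Uw [Uw' Ew]] Pz Pw; rewrite /glue /F /=.
have Dz := fold_disc Pz; have Dw := fold_disc Pw.
have [eq|ne] := eqVneq (upper z) (upper w); first by rewrite -eq H.
have Dr d : D (radial d) by exact: radial_disc.
rewrite (H _ (fold z) (radial (fold z)))// (H _ (radial (fold z)) (radial (fold w)))//.
rewrite (H _ (radial (fold w)) (fold w))//.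
rewrite (E _ (upper z) true Uz' Ez) (E _ (upper w) true Uw' Ew).
by case: (u true x (radial (fold z))) (u true x (radial (fold w)))
  (u (upper z) x (fold z)) (u (upper w) x (fold w)) => [] [] [] [].
Qed.

(** The class is [r] times the angular class around [q], up to a trivial class on
    a punctured neighbourhood of [q]. *)
Definition residue (c : space -> space -> bool) (q : space) (r : bool) : Prop :=
  exists U, [/\ open U, U q & exact ((P `&` U) `\` [set q])
    (fun y z => c y z (+) (r && pullback fold (winding (fold q)) y z))].

Lemma residueD c d q r s : residue c q r -> residue d q s ->
  residue (addc c d) q (r (+) s).
Proof.
move=> [U [oU Uq exU]] [V [oV Vq exV]]; exists (U `&` V); split => //.
- exact: openI.
- have {}exU : exact ((P `&` (U `&` V)) `\` [set q]) (fun y z => c y z (+) (r && pullback fold (winding (fold q)) y z)).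
    by apply: exactS exU => y [[? [? ?]] ?].
  have {}exV : exact ((P `&` (U `&` V)) `\` [set q]) (fun y z => d y z (+) (s && pullback fold (winding (fold q)) y z)).
    by apply: exactS exV => y [[? [? ?]] ?].
  have [g Hg] := exactD exU exV; exists g; move: Hg; congr primitive.
  apply/funext => y; apply/funext => z; rewrite /addc.
  by case: (c y z) (d y z) r s (pullback _ _ _ _) {exU exV} => [] [] [] [] [].
Qed.

Lemma residue_exact c q U : open U -> U q ->
  exact ((P `&` U) `\` [set q]) c -> residue c q false.
Proof.
move=> oU Uq [g Hg]; exists U; split => //; exists g; move: Hg.
by congr primitive; apply/funext => y; apply/funext => z; rewrite addbF.
Qed.

Lemma residue_cocycle_at c q : cocycle_at P c q -> residue c q false.
Proof.
move=> /cocycle_local_exact[U [oU Uq exU]]; apply: residue_exact oU Uq _.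
by apply: exactS exU => y [].
Qed.

Lemma residue_unique c q : P q -> q 0 1 != 0 ->
  residue c q true -> residue c q false -> False.
Proof.
move=> Pq ne rT rF; have [U [oU Uq exU]] := residueD rT rF.
set Q := fold q in exU; pose k := upper q.
have qE : sheet k Q = q by exact: sheet_upper.
have /andP[_ Q1] : 0 < sqnorm Q < 1 by exact: fold_regular.
have [e1 e10 He1] := open_disc_box Q1.
have : \forall d \near Q, U (sheet k d).
  by apply: (@sheet_continuous k Q); apply: open_nbhs_nbhs; rewrite qE.
move=> /(@near_pair R)[e2 e20 He2].
pose e := Num.min e1 e2.
have e0 : 0 < e by rewrite lt_min e10.
apply: (@winding_not_exact R Q e e0).
have sub d : (box_around Q e `\` [set Q]) d -> D d /\ (((P `&` U) `\` [set q]) (sheet k d)).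
  rewrite /box_around /e /= => -[[]]; rewrite !lt_min => /andP[h1 h2] /andP[h3 h4] dQ.
  have Dd : D d by apply: He1.
  split => //; split; first by split; [exact: sheet_in|exact: He2].
  by move=> /(congr1 fold); rewrite foldK.
have [g Hg] : exact (box_around Q e `\` [set Q]) (pullback (sheet k) (fun y z =>
    addc c c y z (+) ((true (+) false) && pullback fold (winding Q) y z))).
  apply: exact_pullback exU; last by move=> d /sub[].
  by apply: continuous_cont_on => d; exact: sheet_continuous.
exists g => d Bd; have := Hg d Bd; apply: filterS => d' H Bd'; have := H Bd'.
have [Dd _] := sub _ Bd; have [Dd' _] := sub _ Bd'.
by rewrite /pullback /addc addbb !foldK.
Qed.



Lemma regular_inj y z : P y -> P z -> upper y = upper z -> fold y = fold z -> y = z.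
Proof. by move=> Py Pz E F; rewrite -(sheet_upper Py) -(sheet_upper Pz) E F. Qed.

(** On each half take the sum of the angular classes around those of the two points
    that lie in this half. On the boundary circle the classes of the two halves
    differ by the sum of both angular classes, which is the coboundary of some [g]
    there; adding the coboundary of [g] on the lower half makes them agree. *)
Lemma dipole q q' : P q -> P q' -> q 0 1 != 0 -> q' 0 1 != 0 -> q != q' ->
  exists2 c, forall y, P y -> y != q -> y != q' -> cocycle_at P c y & residue c q true.
Proof.
move=> Pq Pq' q0 q0' qq'; set Q := fold q; set Q' := fold q'.
have /andP[Q0 Q1] : 0 < sqnorm Q < 1 by exact: fold_regular.
have /andP[Q0' Q1'] : 0 < sqnorm Q' < 1 by exact: fold_regular.
have [g Hg] := winding_circle_homologous Q1 Q1'.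
pose u k : R * R -> R * R -> bool := addc (fun d e => (upper q == k) && winding Q d e)
  (addc (fun d e => (upper q' == k) && winding Q' d e)
        (fun d e => ~~ k && (g d (+) g e))).
have cu k x : (upper q == k -> x != Q) -> (upper q' == k -> x != Q') -> cocycle_at D (u k) x.
  move=> h h'; apply: cocycle_atD; last apply: cocycle_atD.
  - by apply: cocycle_at_mask => /h; exact: winding_cocycle_at.
  - by apply: cocycle_at_mask => /h'; exact: winding_cocycle_at.
  - by apply: cocycle_at_mask => _; exact: cocycle_at_coboundary.
exists (glue u).
  move=> y Py yq yq'; have [y0|y0] := eqVneq (y 0 1) 0; last first.
    apply: glue_regular => //; apply: cu => /eqP E.
      by apply: contra_neq yq => F; exact: regular_inj.
    by apply: contra_neq yq' => F; exact: regular_inj.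
  have seam := seam_fold Py y0.
  have nQ p : 0 < sqnorm p -> sqnorm p < 1 -> fold y != p.
    move=> p0 p1; apply/eqP => E; case: seam => F; first by move: p1; rewrite -E F ltxx.
    by move: p0; rewrite -E F /sqnorm /= expr0n addr0 ltxx.
  apply: glue_seam => //; first by move=> k; apply: cu => _; exact: nQ.
  case: seam => [x1|x0]; last first.
    apply/near_pair; exists 1 => // p _ _; rewrite x0 /sqnorm /= expr0n addr0 => /eqP.
    by rewrite eq_sym oner_eq0.
  have := Hg _ x1; apply: filterS => d H _ /H; rewrite /u /addc /=.
  case: (winding Q _ _) (winding Q' _ _) (g _) (g _) => [] [] [] [] //= _;
  by case: (upper q) (upper q') => [] [].
have cc : cocycle_at P (fun y z => glue u y z (+) (true && pullback fold (winding Q) y z)) q.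
  apply: (@cocycle_at_near _ _ [set z | upper z = upper q]
    (pullback fold (addc (fun d e => (upper q' == upper q) && winding Q' d e)
        (fun d e => ~~ upper q && (g d (+) g e))))) => //.
  - exact: near_upper.
  - move=> y z Uy Uz Py Pz; rewrite /glue /= Uy Uz eqxx /u /addc eqxx /= /pullback.
    by rewrite addbAC addbb.
  apply: (@cocycle_at_pullback _ _ P D) => //.
  - by apply: continuous_cont_on => y; exact: fold_continuous.
  - exact: fold_disc.
  apply: cocycle_atD.
    apply: cocycle_at_mask => /eqP E; apply: winding_cocycle_at.
    by apply: contra_neq qq' => F; exact: regular_inj.
  by apply: cocycle_at_mask => _; exact: cocycle_at_coboundary.
have [U [oU Uq exU]] := cocycle_local_exact cc; exists U; split => //.
by apply: exactS exU => y [].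
Qed.

(** It counts mod 2 the crossings of the outer circle [u = 0], along which the two
    halves meet with [x > 0]. At [x = 0] the two halves are apart, so cutting off
    there keeps the class locally additive. *)
Definition handle : space -> space -> bool := fun y z =>
  [&& 0 < y 0 0, 0 < z 0 0 & upper y (+) upper z].

Lemma sheet_x0 k d : D d -> sqnorm d = 1 \/ d = (0, 0) -> (sheet k d) 0 0 != 0.
Proof.
move=> Dd h; rewrite /sheet point3E mulf_neq0//; first by rewrite gt_eqF ?rho_gt0.
case: h => [->|->]; first by rewrite mulr1 (_ : 2 - 1 = 1) ?oner_eq0//; ring.
by rewrite /sqnorm /= expr0n addr0 mulr0 sub0r oppr_eq0 oner_eq0.
Qed.

Lemma handle_cocycle : cocycle P handle.
Proof.
move=> x Px; have c0 : continuous (fun y : space => y 0 0) by exact: coord_continuous.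
have [lt|gt|eq0] := ltgtP (x 0 0) 0.
- exists [set y : space | y 0 0 < 0]; first exact: cvgr_lt _ (c0 x) _ lt.
  move=> y z /= ly lz _ _; rewrite /handle.
  by rewrite !(ltNge 0) (ltW ly) (ltW lz) (ltW lt).
- exists [set y : space | 0 < y 0 0]; first exact: cvgr_gt _ (c0 x) _ gt.
  move=> y z /= ly lz _ _; rewrite /handle ly lz gt /=.
  by case: (upper x) (upper y) (upper z) => [] [] [].
- have ne : x 0 1 != 0.
    apply/eqP => x1; have := sheet_x0 (upper x) (fold_disc Px) (seam_fold Px x1).
    by rewrite sheet_upper// eq0 eqxx.
  exists [set y : space | upper y = upper x]; first exact: near_upper.
  by move=> y z /= Ey Ez _ _; rewrite /handle Ey Ez addbb !andbF.
Qed.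

Definition pinch : space := sheet true (0, 0).

Lemma disc0 : D (0, 0).
Proof. by rewrite /disc /sqnorm /= expr0n addr0 ler01. Qed.

Lemma conn_half k : conn (half_torus k).
Proof.
have -> : half_torus k = sheet k @` D.
  apply/seteqP; split=> [y Hy|_ [d Dd <-]]; last exact: sheet_half.
  by have [? ?] := half_torusP Hy; exists (fold y).
apply: conn_image; first by apply: conn_convex; exact: convex_disc.
by apply: continuous_cont_on => d; exact: sheet_continuous.
Qed.

Lemma pinch_half k : half_torus k pinch.
Proof.
rewrite /pinch -(@sheet_seam k (0, 0)); first by apply: sheet_half; exact: disc0.
by right.
Qed.

Lemma conn_torus : conn P.
Proof.
have -> : P = half_torus true `|` half_torus false.
  apply/seteqP; split=> [y /half_torus_cover|y [[]|[]]//].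
  by case: (upper y); [left|right].
by apply: (connU (x := pinch)); (exact: conn_half || exact: pinch_half).
Qed.

(** A primitive is constant on the closed upper half and on the open lower half, with
    the same constant because of the pinch point, but it changes across the outer
    circle. *)
Lemma handle_not_exact : ~ exact P handle.
Proof.
move=> [g Hg].
pose e1 : R * R := (1, 0).
have e11 : sqnorm e1 = 1 by rewrite /sqnorm /= expr1n expr0n addr0.
have De1 : D e1 by rewrite /disc /= e11.
pose x := sheet true e1.
have xF : sheet false e1 = x by apply: sheet_seam; left.
have Px : P x by exact: sheet_in.
(* on the closed upper half the class vanishes *)
have [s1 S1] : exists s, forall y, half_torus true y -> g y = false (+) s.
  apply: (@primitive_conn _ _ handle); first exact: conn_half.
    by apply: primitiveS Hg => y [].
  apply: primitive_pointwise => y z [_ /=]; rewrite !mul1r /handle /upper => -> [_ /=].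
  by rewrite mul1r => ->; rewrite !andbF.
(* so does it on the open lower half, pinch point included *)
pose O : set (R * R) := [set d | sqnorm d < 1].
have cO : conn O.
  apply: conn_convex => d e t; rewrite /O /sqnorm /= => hd he /andP[t0 t1].
  rewrite /GRing.scale /=.
  have h1 : 0 <= t * (1 - t) * ((d.1 - e.1) ^+ 2 + (d.2 - e.2) ^+ 2).
    by apply: mulr_ge0; [nra|rewrite addr_ge0// sqr_ge0].
  have t01 : 0 <= t <= 1 by rewrite t0.
  have : - 1 < (1 - t) * - (d.1 ^+ 2 + d.2 ^+ 2) + t * - (e.1 ^+ 2 + e.2 ^+ 2).
    by apply: lt_convex_comb => //; lra.
  by lra.
have OD d : O d -> D d by move=> /ltW.
have low d : O d -> d != (0, 0) -> upper (sheet false d) = false.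
  move=> Od d0; apply: upper_sheet; last exact: OD.
  apply/eqP => /(sheet_height_eq0 (OD _ Od))[h|/eqP]; last by rewrite (negbTE d0).
  by move: Od; rewrite /O /= h ltxx.
have low0 d : O d -> [&& 0 < sheet false d 0 0 & upper (sheet false d)] = false.
  move=> Od; have [->|d0] := eqVneq d (0, 0); last by rewrite low// andbF.
  rewrite /sheet point3E /sqnorm /= expr0n addr0 !mulr0 addr0 sub0r mulrN1.
  by rewrite oppr_gt0 ltNge (ltW (lt_trans b_gt0 b_lt_a)).
have [s2 S2] : exists s, forall d, O d -> g (sheet false d) = false (+) s.
  apply: (@primitive_conn _ _ (pullback (sheet false) handle) (g \o sheet false)) => //.
    apply: primitive_pullback Hg; last by move=> d /OD; exact: sheet_in.
    by apply: continuous_cont_on => d; exact: sheet_continuous.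
  apply: primitive_pointwise => d e /low0 + /low0; rewrite /pullback /handle.
  by case: (0 < _) (upper _) (0 < _) (upper _) => [] [] [] [].
have O0 : O (0, 0) by rewrite /O /= /sqnorm /= expr0n addr0.
have s12 : s1 = s2.
  have := S2 _ O0; rewrite (@sheet_seam false (0, 0)); last by right.
  by rewrite S1; [case: s1 s2 {S1 S2} => [] []|exact: pinch_half].
(* crossing the seam near x changes g *)
have x0 : 0 < x 0 0.
  by rewrite /x /sheet point3E e11 mulr_gt0 ?rho_gt0//; lra.
have nx : \forall d \near e1, 0 < (sheet false d) 0 0 /\ (P (sheet false d) ->
    handle x (sheet false d) = g x (+) g (sheet false d)).
  have c0 : continuous (fun y : space => y 0 0) by exact: coord_continuous.
  pose V : set space := [set y : space | 0 < y 0 0 /\ (P y -> handle x y = g x (+) g y)].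
  have Vx : nbhs (sheet false e1) V.
    by rewrite xF; apply: filterI; [exact: cvgr_gt _ (c0 x) _ x0|exact: Hg].
  exact: (@sheet_continuous false e1 V Vx).
have /(@near_pair R)[e e0 He] := nx.
pose m := Num.min (e / 2) (1 / 2).
have m0 : 0 < m by rewrite lt_min !divr_gt0.
have me : m <= e / 2 by rewrite ge_min lexx.
have m2 : m <= 1 / 2 by rewrite ge_min lexx orbT.
pose d : R * R := (1 - m, 0).
have Od : O d by rewrite /O /sqnorm /= expr0n addr0 expr_lt1//; lra.
have d0 : d != (0, 0) by rewrite xpair_eqE negb_and gt_eqF//; lra.
have [||dx /(_ (sheet_in false (OD _ Od)))] := He d.
- by rewrite /= addrAC subrr add0r normrN gtr0_norm//; lra.
- by rewrite /= subrr normr0.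
rewrite /handle x0 dx low// S2// S1; last exact: sheet_half.
rewrite s12 /upper; have := sheet_height_ge0 true De1; rewrite mul1r => ->.
by case: s2 {S2 s12}.
Qed.

Lemma conn_circle : conn (@circle R).
Proof.
have -> : @circle R = circle_arc (1, 0) (-2).
  apply/seteqP; split=> [p Cp|p []//]; split => //=.
  rewrite /circle /sqnorm /= in Cp; have := sqr_ge0 p.2 => h.
  have : -1 <= p.1 by nra.
  by lra.
by apply: conn_circle_arc; rewrite /sqnorm /= expr1n expr0n addr0.
Qed.

Lemma sgn_both k (t : R) : 0 <= sgn k * t -> 0 <= sgn (~~ k) * t -> t = 0.
Proof. by case: k; rewrite /sgn /=; lra. Qed.

Lemma half_torus_near x : P x -> \forall y \near x, P y ->
  exists k, half_torus k x /\ half_torus k y.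
Proof.
move=> Px; have [x0|x0] := eqVneq (x 0 1) 0.
  apply: (@filterS _ (nbhs x) _ setT); last exact: filterT.
  move=> y _ Py; exists (upper y); split; last exact: half_torus_cover.
  by split; rewrite //= x0 mulr0.
apply: filterS (near_upper x0) => y E Py; exists (upper x).
by split; [exact: half_torus_cover|rewrite -E; exact: half_torus_cover].
Qed.

Lemma half_torusI :
  half_torus true `&` half_torus false = (sheet true @` @circle R) `|` [set pinch].
Proof.
apply/seteqP; split=> [y [[Py /= h1] [_ /= h2]]|y].
  have y0 : y 0 1 = 0 by move: h1 h2; rewrite /sgn; lra.
  have yE : sheet true (fold y) = y by have [|] := @half_torusP true y.
  have [s|s] := seam_fold Py y0; [left; exists (fold y)|right] => //.
  by rewrite /= -yE s.
have both d : D d -> sqnorm d = 1 \/ d = (0, 0) ->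
    (half_torus true `&` half_torus false) (sheet true d).
  move=> Dd s; split; first exact: sheet_half.
  by rewrite -(sheet_seam false s); exact: sheet_half.
case=> [[d Cd <-]|->]; apply: both; [|by left| exact: disc0|by right].
by rewrite /disc /= Cd.
Qed.

Lemma exact_half k c (A : set space) : A `<=` half_torus k -> cocycle A c ->
  exact (D `&` [set d | A (sheet k d)]) (pullback (sheet k) c) -> exact A c.
Proof.
move=> AH cc; apply: (@exact_section _ _ _ _ (sheet k) fold).
- by apply: continuous_cont_on => y; exact: fold_continuous.
- by move=> y Ay; have [Dy yE] := half_torusP (AH _ Ay); split => //=; rewrite yE.
- by move=> y Ay; have [Dy yE] := half_torusP (AH _ Ay).
Qed.

(** The half that misses [q] is a disc, so the classes are trivial on it and hence
    on the boundary circle, hence also on the half punctured at [q]. The two pieces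
    meet in the circle and the pinch point, both connected. *)
Lemma punctured_torus_two_classes q c d : P q -> q 0 1 != 0 ->
  cocycle (P `\` [set q]) c -> cocycle (P `\` [set q]) d ->
  [\/ exact (P `\` [set q]) c, exact (P `\` [set q]) d |
      exact (P `\` [set q]) (addc c d)].
Proof.
move=> Pq q0 cc cd; pose k := upper q; set Q := fold q.
have qE : sheet k Q = q by exact: sheet_upper.
have /andP[Q0 Q1] : 0 < sqnorm Q < 1 by exact: fold_regular.
have qN : ~ half_torus (~~ k) q.
  move=> [_ /=]; have [_ /=] := half_torus_cover Pq; rewrite -/k.
  by move=> h1 h2; move: q0; rewrite (sgn_both h1 h2) eqxx.
have scont l A' : cont_on A' (sheet l).
  by apply: continuous_cont_on => e; exact: sheet_continuous.
have exN e : cocycle (P `\` [set q]) e -> exact (half_torus (~~ k)) e.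
  move=> ce.
  have sub : half_torus (~~ k) `<=` P `\` [set q].
    by move=> y Hy; split; [case: Hy|move=> yq; apply: qN; rewrite -yq].
  have ce' := cocycleS sub ce.
  apply: (@exact_half (~~ k)) => //.
  have -> : D `&` [set d | half_torus (~~ k) (sheet (~~ k) d)] = D.
    by apply/seteqP; split=> [p []//|p Dp]; split => //; exact: sheet_half.
  apply: exact_convex; first exact: convex_disc.
  by apply: cocycle_pullback ce' => // p; exact: sheet_half.
have exK e : cocycle (P `\` [set q]) e -> exact (half_torus k `\` [set q]) e.
  move=> ce.
  have ce' : cocycle (half_torus k `\` [set q]) e by apply: cocycleS ce => y [[]].
  apply: (@exact_half k) => //.
  have -> : D `&` [set d | (half_torus k `\` [set q]) (sheet k d)] = D `\` [set Q].
    apply/seteqP; split=> p [Dp] h; split => //.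
      by move=> pQ; case: h => _; apply; rewrite pQ.
    by split; [exact: sheet_half|move=> /(congr1 fold); rewrite foldK].
  apply: exact_punctured_disc => //.
    apply: cocycle_pullback ce' => // p [Dp pQ]; split; first exact: sheet_half.
    by move=> /(congr1 fold); rewrite foldK.
  have CD : @circle R `<=` D by move=> p Cp; rewrite /disc /= Cp.
  have [g Hg] : exact (@circle R) (pullback (sheet (~~ k)) e).
    by apply: exact_pullback (exN _ ce) => // p /CD; exact: sheet_half.
  exists g => p Cp; have := Hg p Cp; apply: filterS => p' H Cp'; have := H Cp'.
  by rewrite /pullback !(@sheet_seam (~~ k))//; [rewrite !(@sheet_seam k)//|..]; by left.
have kk : half_torus k `&` half_torus (~~ k) = half_torus true `&` half_torus false.
  by case: (k); rewrite //= setIC.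
apply: (@two_pieces _ _ (half_torus k `\` [set q]) (half_torus (~~ k)) _
  (sheet true @` @circle R) [set pinch]).
- move=> x [Px xq].
  apply: filterS (half_torus_near Px) => y H [Py yq]; have [l [lx ly]] := H Py.
  have [E|E] := eqVneq l k; first by left; rewrite -E.
  have <- : l = ~~ k by move: E; case: (l) (k) => [] [].
  by right.
- apply: conn_image => //; exact: conn_circle.
- exact: conn1.
- rewrite -half_torusI -kk; apply/seteqP; split=> y.
    by move=> [[? _] ?]; split.
  by move=> [? h]; split => //; split => // yq; apply: qN; rewrite -yq.
all: by [exact: exK|exact: exN].
Qed.

(** If [x] lies over the circle or over the centre of the disc, move towards the
    interior point [(1 / 2, 0)]. *)
Lemma regular_dense x U : P x -> nbhs x U -> exists y, [/\ P y, U y & y 0 1 != 0].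
Proof.
move=> Px Ux; have [y0|y0] := eqVneq (x 0 1) 0; last first.
  by exists x; split => //; exact: nbhs_singleton.
have Dx := fold_disc Px; have xE := sheet_upper Px.
set d := fold x in Dx xE; set k := upper x in xE.
pose f (t : R) : R * R := ((1 - t) * d.1 + t / 2, (1 - t) * d.2).
have cf : continuous f.
  have cid : continuous (fun t : R => t) by move=> t; exact: cvg_id.
  have c1 : continuous (fun t : R => 1 - t).
    by move=> t; apply: cvgB; [exact: cvg_cst|exact: cvg_id].
  apply: pair_continuous; last exact: continuousMc.
  by apply: continuousDf; exact: continuousMc.
have f0 : f 0 = d by rewrite /f subr0 !mul1r mul0r addr0 -surjective_pairing.
have : \forall t \near (0 : R), U (sheet k (f t)).
  apply: (cf 0 [set d | U (sheet k d)]); rewrite f0.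
  by apply: (@sheet_continuous k d); rewrite xE.
move=> /near_norm[e e0 He].
pose t := Num.min (e / 2) (1 / 2).
have t0 : 0 < t by rewrite lt_min !divr_gt0.
have te : t <= e / 2 by rewrite ge_min lexx.
have t2 : t <= 1 / 2 by rewrite ge_min lexx orbT.
have nf : sqnorm (f t) = (1 - t) ^+ 2 * sqnorm d +
    2 * ((1 - t) * d.1) * (t / 2) + (t / 2) ^+ 2.
  by rewrite /f /sqnorm /=; ring.
have /andP[p0 p1] : 0 < sqnorm (f t) < 1.
  have sm : sqnorm d = 1 \/ d = (0, 0) := seam_fold Px y0.
  rewrite nf; case: sm => [d1|d0].
    rewrite d1; have h2 := sqr_ge0 d.2; rewrite /sqnorm in d1.
    have l1 : -1 <= d.1 by nra.
    have l2 : d.1 <= 1 by nra.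
    have h3 : 0 <= (1 - t) * t * (1 + d.1) by rewrite !mulr_ge0//; lra.
    have h4 : 0 <= (1 - t) * t * (1 - d.1) by rewrite !mulr_ge0//; lra.
    have h5 : 0 < (1 - 3 * (t / 2)) ^+ 2 by rewrite exprn_gt0//; lra.
    have h6 : 0 <= t * (1 / 2 - t) by rewrite mulr_ge0//; lra.
    by apply/andP; split; lra.
  by rewrite d0 /sqnorm /= expr0n addr0 !mulr0 !add0r; apply/andP; split; nra.
have Df : D (f t) by exact: ltW.
exists (sheet k (f t)); split; first exact: sheet_in.
  by apply: He; rewrite subr0 gtr0_norm//; lra.
apply/eqP => /(sheet_height_eq0 Df)[E|E]; first by move: p1; rewrite E ltxx.
by move: p0; rewrite E /sqnorm /= expr0n addr0 ltxx.
Qed.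

End Torus.

(** * Barycentric coordinates in a simplex *)

Section Coordinates.
Variables (R : realType) (N : nat).
Local Notation space := 'rV[R]_N.
Implicit Types (s t : {fset space}) (w : space -> R) (x y z p q : space).

Definition barycentric s w x :=
  [/\ forall p, p \in s -> 0 <= w p, \sum_(p <- s) w p = 1 &
      x = \sum_(p <- s) w p *: p].

Lemma convex_hull s : convexly_closed (fset_hull s).
Proof.
move=> x y t [v [v0 v1 ->]] [w [w0 w1 ->]] /andP[t0 t1].
exists (fun p => (1 - t) * v p + t * w p); split.
- by move=> p ps; rewrite addr_ge0// mulr_ge0 ?v0 ?w0//; lra.
- by rewrite big_split /= -!mulr_sumr v1 w1; ring.
- rewrite !scaler_sumr -big_split /=; apply: eq_bigr => p _.
  by rewrite [RHS]scalerDl !scalerA.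
Qed.

Lemma hull_vertex s p : p \in s -> fset_hull s p.
Proof.
move=> ps; exists (fun q => (q == p)%:R); split.
- by move=> q _; rewrite ler0n.
- rewrite (big_fsetD1 p)//= eqxx big_seq big1 ?addr0// => q.
  by rewrite !inE => /andP[/negbTE ->].
- rewrite (big_fsetD1 p)//= eqxx scale1r big_seq big1 ?addr0// => q.
  by rewrite !inE => /andP[/negbTE -> _]; rewrite scale0r.
Qed.

Lemma sum_fset_extend (V : nmodType) s t (F : space -> V) : (t `<=` s)%fset ->
  \sum_(p <- s) (if p \in t then F p else 0) = \sum_(p <- t) F p.
Proof.
move=> ts; rewrite -(big_fset_incl _ ts); last by move=> p _ /negbTE ->.
by rewrite big_seq [RHS]big_seq; apply: eq_bigr => p ->.
Qed.

(** The vectors [(1, p)] for the vertices [p] are linearly independent, so the matrix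
    with these rows has a right inverse; its columns give the coordinates as affine
    functions on the whole space. *)
Lemma affine_coordinates s : affinely_independent s ->
  exists l : space -> space -> R, (forall p, continuous (l p)) /\
    forall w x, \sum_(p <- s) w p = 1 -> x = \sum_(p <- s) w p *: p ->
      forall p, p \in s -> l p x = w p.
Proof.
move=> ind; pose n := size s.
pose A : 'M[R]_(n, 1 + N) := row_mx (const_mx 1) (\matrix_(i, j) (nth 0 s i) 0 j).
have sumE (V : nmodType) (F : space -> V) :
    \sum_(p <- s) F p = \sum_(i < n) F (nth 0 s i).
  by rewrite (big_nth 0) big_mkord.
have AE w : (\row_(i < n) w (nth 0 s i)) *m A =
    row_mx (\sum_(p <- s) w p)%:M (\sum_(p <- s) w p *: p).
  rewrite mul_mx_row !sumE; congr row_mx; apply/rowP => j; rewrite !mxE.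
    by rewrite ord1 eqxx mulr1n; apply: eq_bigr => i _; rewrite !mxE mulr1.
  by rewrite summxE; apply: eq_bigr => i _; rewrite !mxE.
have /row_freeP[B AB] : row_free A.
  apply: inj_row_free => v vA.
  pose w p : R := if insub (index p s) is Some i then v 0 (i : 'I_n) else 0.
  have wE (i : 'I_n) : w (nth 0 s i) = v 0 i.
    rewrite /w index_uniq ?fset_uniq//; case: insubP => [j _ /val_inj -> //|].
    by rewrite ltn_ord.
  have vE : v = \row_(i < n) w (nth 0 s i) by apply/rowP => i; rewrite mxE wE.
  move: vA; rewrite vE AE => E0.
  have [h1 h2] : (\sum_(p <- s) w p)%:M = 0 :> 'M[R]_1 /\ \sum_(p <- s) w p *: p = 0.
    by apply: eq_row_mx; rewrite E0 row_mx0.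
  have {}h1 : \sum_(p <- s) w p = 0 by move/matrixP: h1 => /(_ 0 0); rewrite !mxE.
  apply/rowP => i; rewrite !mxE; apply: ind => //.
  by apply: mem_nth.
exists (fun p x => if insub (index p s) is Some i
  then (row_mx 1%:M x *m B) 0 (i : 'I_n) else 0).
split=> [p|w x w1 xE p ps].
  case: insub => [i|]; last exact: continuous_constant.
  have -> : (fun x => (row_mx 1%:M x *m B) 0 i) =
      (fun x => B (lshift N 0) i + \sum_(j < N) x 0 j * B (rshift 1 j) i).
    apply/funext => x; rewrite mxE big_split_ord /= big_ord1; congr (_ + _).
      by rewrite row_mxEl mxE mul1r.
    by apply: eq_bigr => j _; rewrite row_mxEr.
  apply: continuousDf; first exact: continuous_constant.
  by apply: (continuous_big add_continuous) => j _; apply: continuousMc; exact: coord_continuous.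
have E : row_mx 1%:M x *m B = \row_(i < n) w (nth 0 s i).
  by rewrite xE -w1 -AE -mulmxA AB mulmx1.
have ip : (index p s < n)%N by rewrite index_mem.
by rewrite insubT E mxE /= nth_index.
Qed.

Lemma barycentric_unique s v w x : affinely_independent s ->
  barycentric s v x -> barycentric s w x -> forall p, p \in s -> v p = w p.
Proof.
move=> /affine_coordinates[l [_ H]] [_ v1 xv] [_ w1 xw] p ps.
by rewrite -(H v x v1 xv p ps) (H w x w1 xw p ps).
Qed.

Lemma closed_hull s : affinely_independent s -> closed (fset_hull s).
Proof.
move=> /affine_coordinates[l [cl H]].
have -> : fset_hull s = \bigcap_(p in [set` s]) [set x | 0 <= l p x] `&`
    [set x | \sum_(p <- s) l p x = 1] `&`
    \bigcap_(j in [set: 'I_N]) [set x : space | x 0 j - (\sum_(p <- s) l p x *: p) 0 j = 0].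
  apply/seteqP; split=> [x [w [w0 w1 xE]]|x [[h0 h1] hx]].
    have lE p : p \in s -> l p x = w p by exact: H.
    have E1 : \sum_(p <- s) l p x *: p = x.
      by rewrite {2}xE big_seq [RHS]big_seq; apply: eq_bigr => p ps; rewrite lE.
    split; [split=> /= [p ps|]|move=> j _ /=].
    - by rewrite /= lE// w0.
    - rewrite /= -w1 big_seq [RHS]big_seq; apply: eq_bigr => p ps.
      by rewrite lE.
    - by rewrite E1 subrr.
  exists (fun p => l p x); split => //.
  by apply/rowP => j; have /eqP := hx j I; rewrite subr_eq0 => /eqP.
have closed_eq0 (f : space -> R) r : continuous f -> closed [set x | f x = r].
  by move=> /continuous_closedP/(_ [set t | t = r]); apply; exact: closed_eq.
have csum : continuous (fun x => \sum_(p <- s) l p x).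
  by apply: (continuous_big add_continuous) => p _; exact: cl.
apply: closedI; first apply: closedI.
- apply: closed_bigI => p _.
  have /continuous_closedP/(_ [set t | 0 <= t]) := cl p.
  by apply; exact: closed_ge.
- exact: closed_eq0.
- apply: closed_bigI => j _; apply: closed_eq0.
  apply: continuousDf; first exact: coord_continuous.
  have -> : (fun x : space => - (\sum_(p <- s) l p x *: p) 0 j) =
      (fun x => \sum_(p <- s) l p x * (- (p 0 j))).
    apply/funext => x; rewrite summxE -sumrN; apply: eq_bigr => p _.
    by rewrite mxE mulrN.
  apply: (continuous_big add_continuous) => p _.
  by apply: continuousMc; exact: cl.
Qed.

Lemma hull_fset1 p x : fset_hull [fset p]%fset x -> x = p.
Proof. by move=> [w [_]]; rewrite !big_seq_fset1 => -> ->; rewrite scale1r. Qed.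

Lemma hullS s t : (t `<=` s)%fset -> fset_hull t `<=` fset_hull s.
Proof.
move=> ts x [w [w0 w1 xE]]; exists (fun p => if p \in t then w p else 0); split.
- by move=> p ps; case: ifPn => // /w0.
- by rewrite sum_fset_extend.
- rewrite xE -(sum_fset_extend _ ts); apply: eq_bigr => p _.
  by case: ifP => //; rewrite scale0r.
Qed.

End Coordinates.

(** * Simplicial complexes: coordinates and cochains *)

Lemma seq_argmax (R : realType) (T : eqType) (r : seq T) (f : T -> R) x0 :
  x0 \in r -> exists2 v, v \in r & forall p, p \in r -> f p <= f v.
Proof.
elim: r x0 => // a r IH x0 _; case: r IH => [_|b r IH].
  by exists a; rewrite ?mem_head// => p; rewrite inE => /eqP ->.
have [|v vr vmax] := IH b; first exact: mem_head.
have [h|h] := leP (f v) (f a).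
  exists a; first exact: mem_head.
  by move=> p; rewrite inE => /orP[/eqP -> //|/vmax h']; exact: le_trans h.
exists v; first by rewrite inE vr orbT.
by move=> p; rewrite inE => /orP[/eqP ->|/vmax //]; exact: ltW.
Qed.

Lemma near_all_in (T : topologicalType) (I : eqType) (r : seq I) (P : T -> I -> Prop) (x : T) :
  (forall i, i \in r -> \forall y \near x, P y i) ->
  \forall y \near x, forall i, i \in r -> P y i.
Proof.
elim: r => [|i r IH] H; first by apply: (@filterS _ (nbhs x) _ setT); last exact: filterT.
have Hi := H i (mem_head _ _); have {}IH := IH (fun j jr => H j (@mem_behead _ (i :: r) j jr)).
by apply: filterS2 Hi IH => y Pi Pr j; rewrite inE => /orP[/eqP -> //|]; exact: Pr.
Qed.

Section Complex.
Variables (R : realType) (N : nat) (C : {fset {fset 'rV[R]_N}}).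
Hypothesis HC : simplicial_complex2 C.
Local Notation space := 'rV[R]_N.
Local Notation K := (realization C).
Implicit Types (s t f : {fset space}) (w : space -> R) (x y z p q u v : space).

Lemma realizationP x : K x <-> exists2 s, s \in C & fset_hull s x.
Proof. by split=> [[s sC sx]|[s sC sx]]; exists s. Qed.

Lemma face_in s t : s \in C -> t != fset0 -> (t `<=` s)%fset -> t \in C.
Proof. by move=> sC t0 ts; apply: (sc2_face HC sC). Qed.

Lemma hull_intersection s t x : s \in C -> t \in C -> fset_hull s x -> fset_hull t x ->
  exists f, [/\ f \in C, (f `<=` s)%fset, (f `<=` t)%fset &
                fset_hull s `&` fset_hull t = fset_hull f].
Proof.
move=> sC tC sx tx; have [E|[f [[f0 fs] [_ ft] E]]] := sc2_inter HC sC tC.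
  by have : (fset_hull s `&` fset_hull t) x by []; rewrite E.
by exists f; split => //; exact: face_in fs.
Qed.

Lemma barycentric_face s f w x : (f `<=` s)%fset -> barycentric f w x ->
  barycentric s (fun p => if p \in f then w p else 0) x.
Proof.
move=> fs [w0 w1 xE]; split.
- by move=> p ps; case: ifPn => // /w0.
- by rewrite sum_fset_extend.
- rewrite xE -(sum_fset_extend _ fs); apply: eq_bigr => p _.
  by case: ifP => //; rewrite scale0r.
Qed.

(** Both simplices contain a common face around [x], and extending by zero the
    coordinates with respect to this face gives the coordinates in either. *)
Lemma barycentric_compat s t (v w : space -> R) x : s \in C -> t \in C ->
  barycentric s v x -> barycentric t w x ->
  forall p, p \in s -> v p = if p \in t then w p else 0.
Proof.
move=> sC tC sv tw p ps.
have [||f [fC fs ft E]] := @hull_intersection s t x sC tC; [by exists v|by exists w|].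
have [r fr] : fset_hull f x by rewrite -E; split; [exists v|exists w].
have := barycentric_unique (sc2_indep HC sC) sv (barycentric_face fs fr) ps.
move=> ->; have := barycentric_unique (sc2_indep HC tC) tw (barycentric_face ft fr).
case: ifPn => pf H; first by rewrite (fsubsetP ft)// H ?pf// (fsubsetP ft).
by case: ifPn => // pt; rewrite H// (negbTE pf).
Qed.

(** The barycentric coordinates of [x] in any simplex that contains it, zero at the
    other points. *)
Definition bc x p : R :=
  if pselect (exists sw : {fset space} * (space -> R),
    sw.1 \in C /\ barycentric sw.1 sw.2 x) is left e
  then let sw := projT1 (cid e) in if p \in sw.1 then sw.2 p else 0 else 0.

Lemma bcE s w x p : s \in C -> barycentric s w x -> bc x p = if p \in s then w p else 0.
Proof.
move=> sC sw; rewrite /bc; case: pselect => [e|]; last by case; exists (s, w).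
case: (cid e) => -[t r] /= [tC tr].
case: ifPn => pt; first exact: barycentric_compat tC sC tr sw p pt.
case: ifPn => ps //; rewrite (barycentric_compat sC tC sw tr ps).
by rewrite (negbTE pt).
Qed.

Lemma bc_out s x p : s \in C -> fset_hull s x -> p \notin s -> bc x p = 0.
Proof. by move=> sC [w sw] /negbTE ps; rewrite (bcE p sC sw) ps. Qed.

Lemma bc_barycentric s x : s \in C -> fset_hull s x -> barycentric s (bc x) x.
Proof.
move=> sC [w sw]; have E p : p \in s -> bc x p = w p.
  by move=> ps; rewrite (bcE p sC sw) ps.
case: (sw) => w0 w1 xE; split.
- by move=> p ps; rewrite E// w0.
- by rewrite -w1 big_seq [RHS]big_seq; exact: eq_bigr.
- by rewrite {1}xE big_seq [RHS]big_seq; apply: eq_bigr => p ps; rewrite E.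
Qed.

Lemma bc_ge0 x p : 0 <= bc x p.
Proof.
rewrite /bc; case: pselect => // e; case: (cid e) => -[t r] /= [tC [r0 _ _]].
by case: ifPn => // /r0.
Qed.

Lemma bc_eq s w x p : s \in C -> barycentric s w x -> p \in s -> bc x p = w p.
Proof. by move=> sC sw ps; rewrite (bcE p sC sw) ps. Qed.

Lemma bc_near x p (e : R) : K x -> 0 < e ->
  \forall y \near x, K y -> `|bc y p - bc x p| < e.
Proof.
move=> Kx e0.
have H : \forall y \near x, forall s, s \in enum_fset C -> fset_hull s y -> `|bc y p - bc x p| < e.
  apply: near_all_in => s sC.
  have [sx|nsx] := pselect (fset_hull s x); last first.
    have := closed_hull (sc2_indep HC sC); rewrite -openC => oC.
    have : nbhs x (~` fset_hull s) by apply: open_nbhs_nbhs.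
    by apply: filterS => y h /h.
  have [ps|ps] := boolP (p \in s); last first.
    apply: (@filterS _ (nbhs x) _ setT); last exact: filterT.
    by move=> y _ sy; rewrite (bc_out sC sy ps) (bc_out sC sx ps) subrr normr0.
  have [l [cl Hl]] := affine_coordinates (sc2_indep HC sC).
  have lE y : fset_hull s y -> bc y p = l p y.
    by move=> sy; have [_ h1 h2] := bc_barycentric sC sy; rewrite (Hl (bc y) y).
  have : \forall y \near x, `|l p y - l p x| < e.
    have /cvgrPdist_lt/(_ e e0) := cl p x.
    by apply: filterS => y; rewrite distrC.
  by apply: filterS => y h sy; rewrite !lE.
apply: filterS H => y H /realizationP[s sC sy].
exact: (H s).
Qed.

Definition vertices : {fset space} := (\bigcup_(s <- C) s)%fset.

Lemma vertexP p : reflect (exists2 s, s \in C & p \in s) (p \in vertices).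
Proof.
apply: (iffP (bigfcupP _ _ _ _)) => [[s]|[s sC ps]]; last by exists s; rewrite ?sC.
by rewrite andbT => sC ps; exists s.
Qed.

Lemma vertex_in p : p \in vertices -> [fset p]%fset \in C.
Proof.
move=> /vertexP[s sC ps]; apply: (face_in sC); last by rewrite fsub1set.
by apply/fset0Pn; exists p; rewrite inE.
Qed.

Lemma edge_in s u v : s \in C -> u \in s -> v \in s -> [fset u; v]%fset \in C.
Proof.
move=> sC us vs; apply: (face_in sC).
  by apply/fset0Pn; exists u; rewrite !inE eqxx.
by apply/fsubsetP => p; rewrite !inE => /orP[]/eqP ->.
Qed.

Lemma bc_vertex u p : u \in vertices -> bc u p = (p == u)%:R.
Proof.
move=> /vertex_in uC.
have bu : barycentric [fset u]%fset (fun _ => 1) u.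
  by split=> [? _||]; rewrite ?ler01// big_seq_fset1// scale1r.
by rewrite (bcE p uC bu) inE; case: eqP.
Qed.

Section Weighted.
Variable alpha : space -> R.
Hypothesis alpha_gt0 : forall p, 0 < alpha p.

(** The weights [alpha] make it possible to choose at which interior point of a given
    triangle all three vertices are maximal. *)
Definition maximal x v :=
  v \in vertices /\ forall p, p \in vertices -> alpha p * bc x p <= alpha v * bc x v.

Lemma bc_pos_exists s x : s \in C -> fset_hull s x -> exists2 p, p \in s & 0 < bc x p.
Proof.
move=> sC sx; have [_ s1 _] := bc_barycentric sC sx.
apply: contrapT => H; have : \sum_(p <- s) bc x p = 0.
  rewrite big_seq big1// => p ps; apply/eqP; rewrite eq_le bc_ge0 andbT leNgt.
  by apply/negP => h; apply: H; exists p.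
by rewrite s1 => /eqP; rewrite oner_eq0.
Qed.

Lemma maximal_exists x : K x -> exists v, maximal x v.
Proof.
move=> /realizationP[s sC sx]; have [p ps _] := bc_pos_exists sC sx.
have pV : p \in vertices by apply/vertexP; exists s.
have [v vV vm] := seq_argmax (fun p => alpha p * bc x p) pV.
by exists v; split.
Qed.

Lemma maximal_gt0 x v : K x -> maximal x v -> 0 < bc x v.
Proof.
move=> /realizationP[s sC sx] [vV vm]; have [p ps p0] := bc_pos_exists sC sx.
have pV : p \in vertices by apply/vertexP; exists s.
have : 0 < alpha v * bc x v by apply: lt_le_trans (vm p pV); rewrite mulr_gt0.
by rewrite pmulr_rgt0.
Qed.

Lemma maximal_in s x v : s \in C -> fset_hull s x -> maximal x v -> v \in s.
Proof.
move=> sC sx mv; have Kx : K x by apply/realizationP; exists s.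
have := maximal_gt0 Kx mv; apply: contraTT => vs.
by rewrite (bc_out sC sx vs) ltxx.
Qed.

(** Barycentric coordinates are continuous and there are finitely many vertices, so
    strict inequalities persist. *)
Lemma maximal_near x : K x -> \forall y \near x, K y -> forall v, maximal y v -> maximal x v.
Proof.
move=> Kx.
have H : \forall y \near x, forall v, v \in enum_fset vertices -> K y -> maximal y v -> maximal x v.
  apply: near_all_in => v vV.
  have [mv|nmv] := pselect (maximal x v).
    by apply: (@filterS _ (nbhs x) _ setT); last exact: filterT.
  have [p pV lt] : exists2 p, p \in vertices & alpha v * bc x v < alpha p * bc x p.
    apply: contrapT => h; apply: nmv; split => // p pV; rewrite leNgt.
    by apply/negP => lt; apply: h; exists p.
  pose e := (alpha p * bc x p - alpha v * bc x v) / (alpha p + alpha v).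
  have app := alpha_gt0 p; have avp := alpha_gt0 v.
  have e0 : 0 < e by rewrite divr_gt0 ?subr_gt0 ?addr_gt0.
  have eE : alpha p * e + alpha v * e = alpha p * bc x p - alpha v * bc x v.
    by rewrite -mulrDl mulrC divfK// gt_eqF// addr_gt0.
  apply: filterS2 (bc_near p Kx e0) (bc_near v Kx e0) => y h1 h2 Ky [_ /(_ p pV)].
  move: (h1 Ky) (h2 Ky); rewrite !ltr_norml => /andP[l1 _] /andP[_ l2] le.
  exfalso; have : alpha p * (- e) < alpha p * (bc y p - bc x p) by rewrite ltr_pM2l.
  have : alpha v * (bc y v - bc x v) < alpha v * e by rewrite ltr_pM2l.
  by move: eE le; rewrite !mulrBr mulrN; lra.
apply: filterS H => y H Ky v mv.
have vV : v \in vertices by case: mv.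
exact: (H v).
Qed.

Definition sigma x : space :=
  if pselect (exists v, maximal x v) is left e then projT1 (cid e) else 0.

Lemma sigma_maximal x : K x -> maximal x (sigma x).
Proof.
by move=> /maximal_exists e; rewrite /sigma; case: pselect => // e'; exact: (projT2 (cid e')).
Qed.

Lemma sigma_in s x : s \in C -> fset_hull s x -> sigma x \in s.
Proof.
move=> sC sx; apply: (maximal_in sC sx); apply: sigma_maximal.
by apply/realizationP; exists s.
Qed.

Lemma sigma_vertex u : u \in vertices -> sigma u = u.
Proof.
move=> uV; have Ku : K u.
  apply/realizationP; exists [fset u]%fset; first exact: vertex_in.
  by apply: hull_vertex; rewrite inE.
have := maximal_gt0 Ku (sigma_maximal Ku); rewrite bc_vertex//.
by case: eqP => //; rewrite ltxx.
Qed.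

Lemma sigma_near x : K x -> \forall y \near x, K y -> maximal x (sigma y).
Proof.
move=> Kx; apply: filterS (maximal_near Kx) => y H Ky.
by apply: (H Ky); exact: sigma_maximal.
Qed.

Variable kappa : {fset space} -> bool.

Definition edge_value u v := if u == v then false else kappa [fset u; v]%fset.

Definition cochain_class : space -> space -> bool :=
  fun x y => edge_value (sigma x) (sigma y).

Lemma edge_valueC u v : edge_value u v = edge_value v u.
Proof. by rewrite /edge_value eq_sym fsetUC. Qed.

(** For a triangle [t] the faces [t `\ p] are its three edges. *)
Definition edge_sum t : bool := \big[addb/false]_(p <- t) kappa (t `\ p)%fset.

Lemma edge_sum3 (u v w : space) : u != v -> u != w -> v != w ->
  edge_sum [fset u; v; w]%fset = edge_value u v (+) edge_value u w (+) edge_value v w.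
Proof.
move=> uv uw vw; rewrite /edge_sum /edge_value (negbTE uv) (negbTE uw) (negbTE vw).
have -> : [fset u; v; w]%fset = (u |` (v |` [fset w]))%fset by rewrite fsetUA.
rewrite big_fsetU1 /=; last by rewrite !inE negb_or uv uw.
rewrite big_fsetU1 /=; last by rewrite !inE vw.
rewrite big_seq_fset1.
have -> : ((u |` (v |` [fset w])) `\ u = [fset v; w])%fset.
  by apply/fsetP => p; rewrite !inE; have [->|] := eqVneq p u; rewrite ?(negbTE uv) ?(negbTE uw).
have -> : ((u |` (v |` [fset w])) `\ v = [fset u; w])%fset.
  apply/fsetP => p; rewrite !inE; have [->|] := eqVneq p v; rewrite ?orbF ?(negbTE vw)//.
  by rewrite eq_sym (negbTE uv).
have -> : ((u |` (v |` [fset w])) `\ w = [fset u; v])%fset.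
  apply/fsetP => p; rewrite !inE; have [->|] := eqVneq p w; rewrite ?orbF//.
  by rewrite eq_sym (negbTE uw) eq_sym (negbTE vw).
by case: (kappa _) (kappa _) (kappa _) => [] [] [].
Qed.

(** Near [x] all labels are maximal vertices of [x], hence vertices of one simplex
    that contains [x]. Additivity can fail only for three distinct labels, which then
    are the vertices of a triangle and are all maximal at [x]. *)
Lemma cochain_class_cocycle_at x : K x ->
  (forall t, t \in C -> #|` t| = 3%N -> edge_sum t -> fset_hull t x ->
     exists2 p, p \in t & ~ maximal x p) ->
  cocycle_at K cochain_class x.
Proof.
move=> Kx H; have [s sC sx] := (realizationP x).1 Kx.
exists [set y | K y -> maximal x (sigma y)]; first exact: sigma_near.
move=> y z /= Hy Hz Ky Kz; rewrite /cochain_class.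
have mx := sigma_maximal Kx; have my := Hy Ky; have mz := Hz Kz.
set u := sigma x in mx *; set v := sigma y in my *; set w := sigma z in mz *.
have ee p : edge_value p p = false by rewrite /edge_value eqxx.
have [<-|uv] := eqVneq u v; first by rewrite ee.
have [<-|uw] := eqVneq u w; first by rewrite ee addbF edge_valueC.
have [<-|vw] := eqVneq v w; first by rewrite ee addbb.
have sub : ([fset u; v; w] `<=` s)%fset.
  by apply/fsubsetP => p; rewrite !inE => /orP[/orP[]|] /eqP ->; exact: (maximal_in sC sx).
have c3 : #|` [fset u; v; w]%fset| = 3%N.
  have -> : [fset u; v; w]%fset = (u |` (v |` [fset w]))%fset by rewrite fsetUA.
  by rewrite cardfsU1 cardfsU1 cardfs1 !inE negb_or uv uw vw.
have sE : [fset u; v; w]%fset = s.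
  by apply/eqP; rewrite eqEfcard sub c3; case/andP: (sc2_card HC sC).
have := edge_sum3 uv uw vw; case E : (edge_sum _).
  rewrite sE in c3 E; have [p ps np] := H s sC c3 E sx.
  by move: ps np; rewrite -sE !inE => /orP[/orP[]|] /eqP ->.
by case: (edge_value u v) (edge_value u w) (edge_value v w) => [] [] [].
Qed.

(** On the edge the class has the primitive [edge_value u (sigma y)], and any other
    primitive differs from it by a constant. *)
Lemma cochain_class_exact_edge X g u v : u \in vertices -> u != v ->
  [fset u; v]%fset \in C -> fset_hull [fset u; v]%fset `<=` X ->
  primitive X cochain_class g -> kappa [fset u; v]%fset = g u (+) g v.
Proof.
move=> uV uv eC eX Hg; set e := [fset u; v]%fset in eC eX *.
have vV : v \in vertices by apply/vertexP; exists e => //; rewrite !inE eqxx orbT.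
have [|||b Hb] := @primitive_conn _ (fset_hull e) cochain_class g
    (fun y => edge_value u (sigma y)).
- by apply: conn_convex; exact: convex_hull.
- exact: primitiveS Hg.
- apply: primitive_pointwise => y z ey ez; rewrite /cochain_class.
  have := sigma_in eC ey; have := sigma_in eC ez; rewrite !inE.
  have ee p : edge_value p p = false by rewrite /edge_value eqxx.
  by move=> /orP[]/eqP -> /orP[]/eqP ->; rewrite ?ee ?addbb ?addbF// edge_valueC.
rewrite !Hb; try by apply: hull_vertex; rewrite !inE eqxx ?orbT.
rewrite !sigma_vertex// /edge_value eqxx (negbTE uv).
by case: (kappa _) b {Hb} => [] [].
Qed.

End Weighted.

Lemma vertex_function_const (k : space -> bool) : conn K ->
  (forall u v, u != v -> [fset u; v]%fset \in C -> k u = k v) ->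
  forall u v, u \in vertices -> v \in vertices -> k u = k v.
Proof.
move=> cK Hk; pose one (p : space) : R := 1.
have one0 p : 0 < one p by exact: ltr01.
have [x Kx|b Hb] := cK (k \o sigma one).
  apply: filterS (sigma_near one0 Kx) => y H Ky /=.
  have [s sC sx] := (realizationP x).1 Kx.
  have [->//|ne] := eqVneq (sigma one y) (sigma one x).
  apply: Hk => //; apply: (edge_in sC); last exact: sigma_in.
  exact: (maximal_in one0 sC sx (H Ky)).
have kE u : u \in vertices -> k u = b.
  move=> uV; rewrite -(Hb u) /= ?sigma_vertex//.
  apply/realizationP; exists [fset u]%fset; first exact: vertex_in.
  by apply: hull_vertex; rewrite inE.
by move=> u v /kE -> /kE ->.
Qed.

(** A simplex containing a point close to [x] has all vertices of [t] among its own,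
    as these have positive coordinates; having at most three vertices it is [t]. *)
Lemma interior_near t x : t \in C -> #|` t| = 3%N -> fset_hull t x ->
  (forall p, p \in t -> 0 < bc x p) ->
  \forall y \near x, K y -> fset_hull t y /\ forall p, p \in t -> 0 < bc y p.
Proof.
move=> tC t3 tx pos; have Kx : K x by apply/realizationP; exists t.
have H : \forall y \near x, forall p, p \in enum_fset t -> K y -> 0 < bc y p.
  apply: near_all_in => p pt; apply: filterS (bc_near p Kx (pos p pt)) => y h Ky.
  by move: (h Ky); rewrite ltr_norml => /andP[]; lra.
apply: filterS H => y H Ky; split; last by move=> p pt; exact: H.
have [s sC sy] := (realizationP y).1 Ky.
suff -> : t = s by [].
apply/eqP; rewrite eqEfcard t3; apply/andP; split; last by case/andP: (sc2_card HC sC).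
apply/fsubsetP => p pt; apply: contraT => ps.
by have := H p pt Ky; rewrite (bc_out sC sy ps) ltxx.
Qed.

End Complex.

(** * Classes on the one-skeleton *)

Section Skeleton.
Variables (R : realType) (N : nat) (C : {fset {fset 'rV[R]_N}}).
Hypothesis HC : simplicial_complex2 C.
Local Notation space := 'rV[R]_N.
Local Notation K := (realization C).
Local Notation bc := (bc C).
Implicit Types (s t f e : {fset space}) (x y z p q u v : space)
  (c d : space -> space -> bool).

Definition skeleton : set space :=
  [set x | exists s, [/\ s \in C, (#|` s| <= 2)%N & fset_hull s x]].

Lemma bc_affine t y z (a : R) p : t \in C -> fset_hull t y -> fset_hull t z ->
  0 <= a <= 1 -> p \in t ->
  bc ((1 - a) *: y + a *: z) p = (1 - a) * bc y p + a * bc z p.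
Proof.
move=> tC ty tz a01 pt; have [y0 y1 yE] := bc_barycentric HC tC ty.
have [z0 z1 zE] := bc_barycentric HC tC tz.
apply: (@bc_eq _ _ _ HC t (fun p => (1 - a) * bc y p + a * bc z p)) => //.
case/andP: a01 => a0 a1; split.
- by move=> r rt; rewrite addr_ge0// mulr_ge0 ?y0 ?z0//; lra.
- by rewrite big_split /= -!mulr_sumr y1 z1; ring.
- rewrite {1}yE {1}zE !scaler_sumr -big_split /=; apply: eq_bigr => r _.
  by rewrite [RHS]scalerDl !scalerA.
Qed.

Lemma bc_le_eq t x y : t \in C -> fset_hull t x -> fset_hull t y ->
  (forall p, p \in t -> bc x p <= bc y p) -> y = x.
Proof.
move=> tC tx ty le; have [_ x1 xE] := bc_barycentric HC tC tx.
have [_ y1 yE] := bc_barycentric HC tC ty.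
have : \sum_(p <- t) (bc y p - bc x p) = 0 by rewrite sumrB x1 y1 subrr.
rewrite big_seq => /eqP; rewrite psumr_eq0; last by move=> p pt; rewrite subr_ge0 le.
move=> /allP E; rewrite yE xE big_seq [RHS]big_seq; apply: eq_bigr => p pt.
by have := E p pt; rewrite pt subr_eq0 => /eqP ->.
Qed.

Lemma face_card2 t p : t \in C -> #|` t| = 3%N -> p \in t ->
  (t `\ p)%fset \in C /\ #|` (t `\ p)%fset| = 2%N.
Proof.
move=> tC t3 pt; have c2 : #|` (t `\ p)%fset| = 2%N.
  by have := cardfsD1 p t; rewrite pt t3 => -[].
split => //; apply: (face_in HC tC); last exact: fsubD1set.
by rewrite -cardfs_gt0 c2.
Qed.

(** Divide the triangle into the three subtriangles spanned by [x] and an edge, without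
    the apex [x]. They are convex, also after removing the apex, contain an edge each,
    and two of them meet in a convex set that contains a vertex. *)
Lemma exact_punctured_triangle t x c : t \in C -> #|` t| = 3%N -> fset_hull t x ->
  (forall p, p \in t -> 0 < bc x p) -> cocycle (fset_hull t `\` [set x]) c ->
  exact skeleton c -> exact (fset_hull t `\` [set x]) c.
Proof.
move=> tC t3 tx pos cc exG.
have [l [cl Hl]] := affine_coordinates (sc2_indep HC tC).
have lE y p : fset_hull t y -> p \in t -> l p y = bc y p.
  by move=> ty pt; have [_ h1 h2] := bc_barycentric HC tC ty; rewrite (Hl (bc y) y).
(* the subtriangle with apex x opposite to the vertex p, without its apex *)
pose A (p : t) : set space := fset_hull t `&` [set y | bc y (val p) < bc x (val p) /\
  forall q, q \in t -> bc y (val p) * bc x q <= bc y q * bc x (val p)].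
have Asub (p : t) : A p `<=` fset_hull t `\` [set x].
  by move=> y [ty [lt _]]; split => // yx; move: lt; rewrite yx ltxx.
have cvA (p : t) : convexly_closed (A p).
  move=> y z a [ty [ly hy]] [tz [lz hz]] a01; split; first exact: convex_hull.
  have aff := bc_affine tC ty tz a01; case/andP: (a01) => a0 a1.
  have pt : val p \in t by exact: fsvalP.
  split=> [|q qt]; first rewrite (aff _ pt).
    have ly' : - bc x (val p) < - bc y (val p) by rewrite ltrN2.
    have lz' : - bc x (val p) < - bc z (val p) by rewrite ltrN2.
    by have := lt_convex_comb ly' lz' a01; lra.
  rewrite (aff _ pt) (aff _ qt) -subr_ge0.
  have h1 : 0 <= (1 - a) * (bc y q * bc x (val p) - bc y (val p) * bc x q).
    by rewrite mulr_ge0 ?subr_ge0// hy.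
  have h2 : 0 <= a * (bc z q * bc x (val p) - bc z (val p) * bc x q).
    by rewrite mulr_ge0 ?subr_ge0// hz.
  by lra.
have MA (p : t) y : fset_hull (t `\ val p)%fset y -> A p y.
  move=> py; have [fC _] := face_card2 tC t3 (fsvalP p).
  have bp : bc y (val p) = 0 by apply: (bc_out HC fC py); rewrite !inE eqxx.
  split; first by apply: hullS py; exact: fsubD1set.
  split; rewrite bp; first by apply: pos; exact: fsvalP.
  by move=> q qt; rewrite mul0r mulr_ge0 ?bc_ge0.
apply: (@exact_transfer _ _ _ skeleton A (fun p : t => fset_hull (t `\ val p)%fset)) => //.
- pose F (p : t) : set space := \bigcap_(q in [set` t])
    [set y | 0 <= l q y * bc x (val p) + l (val p) y * - bc x q].
  have cF (p : t) : closed (F p).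
    apply: closed_bigI => q _.
    have : continuous (fun y => l q y * bc x (val p) + l (val p) y * - bc x q).
      by apply: continuousDf; exact: continuousMc.
    by move=> /continuous_closedP/(_ [set r | 0 <= r]); apply; exact: closed_ge.
  have FA (p : t) y : (fset_hull t `\` [set x]) y -> F p y -> A p y.
    move=> [ty yx] Fy; have pt := fsvalP p.
    have h q : q \in t -> bc y (val p) * bc x q <= bc y q * bc x (val p).
      by move=> qt; have := Fy q qt; rewrite /= !lE// mulrN subr_ge0.
    split => //; split => //; rewrite ltNge; apply/negP => le; apply: yx.
    apply: (bc_le_eq tC tx ty) => q qt.
    have := h q qt; have xp := pos _ pt; have xq := pos _ qt.
    move=> h1; rewrite -(ler_pM2r xp); apply: le_trans h1.
    by rewrite mulrC ler_pM2r.
  have cov y : (fset_hull t `\` [set x]) y -> exists p : t, F p y.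
    move=> [ty _]; have [p0 p0t _] := bc_pos_exists HC tC tx.
    have [p pt pmin] := seq_argmax (fun q => - (bc y q / bc x q)) p0t.
    exists (FSetSub pt) => q qt; rewrite /= !lE// mulrN subr_ge0.
    have := pmin q qt; rewrite lerN2 ler_pdivlMr ?pos// mulrAC ler_pdivrMr ?pos//.
  move=> y Xy; apply: filterS (closed_cover_near cF cov Xy) => z H Xz.
  by have [p [? ?]] := H Xz; exists p; split; exact: FA.
- by move=> p; apply: exact_convex => //; exact: cocycleS cc.
- move=> p y py; have [fC f2] := face_card2 tC t3 (fsvalP p).
  by split; [exists (t `\ val p)%fset; rewrite f2|exact: MA].
- by move=> p; apply: conn_convex; exact: convex_hull.
move=> p q y pq Ay Aqy; exists (A p `&` A q); split => //.
  by apply: conn_convex; exact: convexly_closedI.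
have [v] : exists v, v \in ((t `\ val p) `\ val q)%fset.
  apply/fset0Pn; rewrite -cardfs_gt0.
  have [_ c2] := face_card2 tC t3 (fsvalP p).
  have := cardfsD1 (val q) (t `\ val p)%fset; rewrite c2 !inE fsvalP andbT.
  by case: (_ != _); case: (#|` _|).
rewrite !inE => /and3P[vq vp vt].
have vP : fset_hull (t `\ val p)%fset v by apply: hull_vertex; rewrite !inE vp.
have vQ : fset_hull (t `\ val q)%fset v by apply: hull_vertex; rewrite !inE vq.
by exists v; split => //; split; exact: MA.
Qed.

(** The cover by simplices, with connected traces on the skeleton; two simplices meet
    in a common face, which contains a vertex. *)
Lemma exact_realization c : cocycle K c -> exact skeleton c -> exact K c.
Proof.
move=> cc exG.
pose M (s : C) : set space := [set x | exists f, [/\ (f `<=` val s)%fset, f != fset0,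
   (#|` f| <= 2)%N & fset_hull f x]].
have MV (s : C) v : v \in val s -> M s v.
  move=> vs; exists [fset v]%fset; rewrite fsub1set vs cardfs1; split => //.
    by apply/fset0Pn; exists v; rewrite inE.
  by apply: hull_vertex; rewrite inE.
have ne f x : fset_hull f x -> f != fset0.
  move=> [w [_ w1 _]]; apply: contraTneq isT => f0; move: w1.
  by rewrite f0 big_seq_fset0 => /eqP; rewrite eq_sym oner_eq0.
apply: (@exact_transfer _ _ _ skeleton (fun s : C => fset_hull (val s)) M) => //.
- move=> x Kx; apply: closed_cover_near => //.
    by move=> s; apply: closed_hull; exact: (sc2_indep HC (fsvalP s)).
  by move=> y /realizationP[s sC sy]; exists (FSetSub sC).
- move=> s; apply: exact_convex; first exact: convex_hull.
  by apply: cocycleS cc => x sx; apply/realizationP; exists (val s) => //; exact: fsvalP.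
- move=> s x [f [fs f0 f2 fx]]; split; last exact: hullS fx.
  by exists f; split => //; exact: (face_in HC (fsvalP s)).
- move=> s; apply: conn_joined => x y [f [fs f0 f2 fx]] [g [gs g0 g2 gy]].
  have [/fset0Pn[u uf] /fset0Pn[v vg]] := (f0, g0).
  pose e := [fset u; v]%fset.
  exists (fset_hull f `|` fset_hull e `|` fset_hull g); split.
  + have [ue ve] : u \in e /\ v \in e by rewrite !inE !eqxx orbT.
    have ch t : conn (fset_hull t) by apply: conn_convex; exact: convex_hull.
    apply: (connU (x := v)) => //; last exact: hull_vertex.
      by apply: (connU (x := u)) => //; exact: hull_vertex.
    by right; exact: hull_vertex.
  + move=> z [[fz|ez]|gz]; [exists f|exists e|exists g]; split => //.
      by apply/fsubsetP => p; rewrite !inE => /orP[]/eqP ->; [exact: (fsubsetP fs)|exact: (fsubsetP gs)].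
    exact: ne ez.
    by rewrite cardfs2; case: (_ != _).
  + by left; left.
  + by right.
- move=> s s' x _ sx sx'; have sC := fsvalP s; have sC' := fsvalP s'.
  have [f [fC fs fs' E]] := hull_intersection HC sC sC' sx sx'.
  have fx : fset_hull f x by rewrite -E.
  have /fset0Pn[v vf] := ne _ _ fx.
  exists (fset_hull f); split => //; first by apply: conn_convex; exact: convex_hull.
    by rewrite E.
  exists v; split; first exact: hull_vertex.
    by apply: MV; exact: (fsubsetP fs).
  by apply: MV; exact: (fsubsetP fs').
Qed.

Definition vertex_sum (k : space -> bool) e : bool := \big[addb/false]_(p <- e) k p.

(** For an edge [e] with end points [u] and [v], the sum is [g u (+) g v], the variation
    of a primitive along [e]. *)
Definition holonomy c e b :=
  exists2 g, primitive (fset_hull e) c g & vertex_sum g e = b.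

Lemma vertex_sum2 k u v : u != v -> vertex_sum k [fset u; v]%fset = k u (+) k v.
Proof.
move=> uv; rewrite /vertex_sum big_fsetU1 /=; last by rewrite inE.
by rewrite big_seq_fset1.
Qed.

Lemma vertex_sumD k l e :
  vertex_sum (fun p => k p (+) l p) e = vertex_sum k e (+) vertex_sum l e.
Proof. exact: big_split. Qed.

Lemma holonomyD c d e b b' : holonomy c e b -> holonomy d e b' ->
  holonomy (addc c d) e (b (+) b').
Proof.
move=> [g Hg <-] [h Hh <-]; exists (fun p => g p (+) h p); first exact: primitiveD.
exact: vertex_sumD.
Qed.

Lemma holonomy_exists c e : cocycle (fset_hull e) c -> exists b, holonomy c e b.
Proof.
move=> cc; have [g Hg] := exact_convex (@convex_hull _ _ e) cc.
by exists (vertex_sum g e), g.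
Qed.

Lemma cardfs2P (T : choiceType) (e : {fset T}) : #|` e| = 2%N ->
  exists u v : T, u != v /\ e = [fset u; v]%fset.
Proof.
move=> e2; have /fset0Pn[u ue] : e != fset0 by rewrite -cardfs_gt0 e2.
have := cardfsD1 u e; rewrite ue e2 => -[/esym/eqP/cardfs1P[v eE]].
exists u, v; split; last by rewrite -(fsetD1K ue) eE.
have : v \in (e `\ u)%fset by rewrite eE inE.
by rewrite !inE eq_sym => /andP[].
Qed.

(** Normalise the primitive on each edge to be [k] at the end points; distinct edges
    meet only in vertices. *)
Lemma exact_skeleton c (k : space -> bool) :
  (forall e, e \in C -> (#|` e| <= 2)%N -> cocycle (fset_hull e) c) ->
  (forall e, e \in C -> #|` e| = 2%N -> holonomy c e (vertex_sum k e)) ->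
  exact skeleton c.
Proof.
move=> cc Hk.
pose A (s : C) : set space := if (#|` val s| <= 2)%N then fset_hull (val s) else set0.
have AE (s : C) x : A s x -> (#|` val s| <= 2)%N /\ fset_hull (val s) x.
  by rewrite /A; case: ifP.
have /choice[g Hg] : forall s : C, exists g, primitive (A s) c g /\
    forall p, (#|` val s| <= 2)%N -> p \in val s -> g p = k p.
  move=> s; rewrite /A; case: ifPn => s2; last by exists k; split.
  have sC := fsvalP s.
  have : (0 < #|` val s|)%N by case/andP: (sc2_card HC sC).
  rewrite leq_eqVlt eq_sym => /orP[/cardfs1P[p sE]|s2'].
    exists (fun _ => k p); split; last by move=> q _; rewrite sE inE => /eqP ->.
    apply: primitive_pointwise => y z; rewrite sE => /hull_fset1 -> /hull_fset1 ->.
    rewrite addbb; apply: (cocycle_refl (cc _ sC s2)).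
    by rewrite sE; apply: hull_vertex; rewrite inE.
  have /eqP e2 : #|` val s| == 2%N by rewrite eqn_leq s2.
  have [g Hg] := Hk _ sC e2.
  have [u [v [uv sE]]] := cardfs2P e2.
  rewrite [fsval s]sE !vertex_sum2// => E.
  exists (fun p => g p (+) (g u (+) k u)); split.
    exact: primitive_const.
  move=> p _; rewrite [val s]sE !inE => /orP[]/eqP ->.
    by case: (g u) (k u) => [] [].
  by move: E; case: (g u) (g v) (k u) (k v) => [] [] [] [].
have [||h Hh _] := @exact_glue _ C skeleton A c g _ (fun s : C => (Hg s).1); last by exists h.
- move=> x; apply: closed_cover_near => [s|y [s [sC s2 sy]]].
    rewrite /A; case: ifP => _; last exact: closed0.
    by apply: closed_hull; exact: (sc2_indep HC (fsvalP s)).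
  by exists (FSetSub sC); rewrite /A /= s2.
- move=> s s' x ss' /AE[s2 sx] /AE[s2' sx'].
  have [f [fC fs fs' E]] := hull_intersection HC (fsvalP s) (fsvalP s') sx sx'.
  have fx : fset_hull f x by rewrite -E.
  have f1 : #|` f| == 1%N.
    rewrite eqn_leq; case/andP: (sc2_card HC fC) => -> _; rewrite andbT leqNgt.
    apply/negP => f2; move/eqP: ss'; apply; apply: val_inj => /=.
    have E1 : f = val s by apply/eqP; rewrite eqEfcard fs (leq_trans s2).
    have E2 : f = val s' by apply/eqP; rewrite eqEfcard fs' (leq_trans s2').
    by rewrite -E1 -E2.
  have /cardfs1P[v fE] := f1.
  move: fx fs fs'; rewrite fE !fsub1set => /hull_fset1 -> vs vs'.
  by rewrite (Hg s).2// (Hg s').2.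
Qed.

End Skeleton.

(** * Counting *)

Section Counting.

Lemma leq_card_surjective (X Y : finType) (f : Y -> X) :
  (forall x, exists y, f y = x) -> (#|X| <= #|Y|)%N.
Proof. by move=> /choice[g Hg]; apply: (@leq_card _ _ g); exact: can_inj Hg. Qed.

Lemma residue_big (R : realType) (a b : R) (I : Type) (r : seq I)
    (c : I -> 'rV[R]_3 -> 'rV[R]_3 -> bool) (s : I -> bool) q :
  (forall i, residue a b (c i) q (s i)) ->
  residue a b (fun y z => \big[addb/false]_(i <- r) c i y z) q (\big[addb/false]_(i <- r) s i).
Proof.
move=> H; elim: r => [|i r IH].
  rewrite big_nil; apply: residue_cocycle_at; exists setT; first exact: filterT.
  by move=> y z _ _ _ _; rewrite !big_nil.
have -> : (fun y z => \big[addb/false]_(j <- i :: r) c j y z) =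
    addc (c i) (fun y z => \big[addb/false]_(j <- r) c j y z).
  by apply/funext => y; apply/funext => z; rewrite big_cons.
by rewrite big_cons; exact: residueD.
Qed.

Lemma residue_mask (R : realType) (a b : R) (e : bool)
    (c : 'rV[R]_3 -> 'rV[R]_3 -> bool) (s : bool) q :
  residue a b c q s -> residue a b (fun y z => e && c y z) q (e && s).
Proof.
case: e => // _; apply: residue_cocycle_at; exists setT; first exact: filterT.
by [].
Qed.

End Counting.

Section Triangulation.
Variables (R : realType) (a b : R).
Hypotheses (b_gt0 : 0 < b) (b_lt_a : b < a).
Variables (N : nat) (C : {fset {fset 'rV[R]_N}}).
Hypothesis HC : simplicial_complex2 C.
Local Notation space := 'rV[R]_N.
Local Notation K := (realization C).
Local Notation P := (pinched_torus a b).
Local Notation bc := (bc C).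
Variables (phi : space -> 'rV[R]_3) (psi : 'rV[R]_3 -> space).
Hypotheses (phi_cont : cont_on K phi) (psi_cont : cont_on P psi).
Hypotheses (phi_in : forall x, K x -> P (phi x)) (psi_in : forall y, P y -> K (psi y)).
Hypotheses (phiK : forall x, K x -> psi (phi x) = x)
           (psiK : forall y, P y -> phi (psi y) = y).

Let hullK s x : s \in C -> fset_hull s x -> K x.
Proof. by move=> sC sx; apply/realizationP; exists s. Qed.

Lemma conn_realization : conn K.
Proof.
have -> : K = psi @` P.
  apply/seteqP; split=> [x Kx|_ [y Py <-]]; last exact: psi_in.
  by exists (phi x); [exact: phi_in|exact: phiK].
by apply: conn_image => //; exact: conn_torus.
Qed.

(** An interior point of the triangle that is sent neither to the pinch point nor to
    the outer circle. *)
Definition generic_point (t : {fset space}) x :=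
  [/\ fset_hull t x, forall p, p \in t -> 0 < bc x p & (phi x) 0 1 != 0].

Lemma generic_point_exists t : t \in C -> #|` t| = 3%N -> exists x, generic_point t x.
Proof.
move=> tC t3; pose x0 : space := \sum_(p <- t) 3^-1 *: p.
have b0 : barycentric t (fun _ => 3^-1) x0.
  split=> //.
  by rewrite big_const_seq count_predT t3 /= addr0; field.
have tx0 : fset_hull t x0 by exists (fun _ => 3^-1).
have pos0 p : p \in t -> 0 < bc x0 p.
  by move=> pt; rewrite (bc_eq HC tC b0 pt) invr_gt0.
have Kx0 := hullK tC tx0.
have near0 := interior_near HC tC t3 tx0 pos0.
have Py0 := phi_in Kx0.
have := psi_cont Py0; rewrite (phiK Kx0) => /(_ _ near0) nearP.
have [y [Py Uy y0]] := regular_dense b_gt0 b_lt_a Py0 nearP.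
have [ty py] := Uy Py (psi_in Py).
by exists (psi y); split => //; rewrite psiK.
Qed.

Lemma generic_point_hull (t s : {fset space}) x : #|` t| = 3%N -> s \in C -> generic_point t x ->
  fset_hull s x -> t = s.
Proof.
move=> t3 sC [_ pos _] sx; apply/eqP; rewrite eqEfcard t3; apply/andP; split.
  apply/fsubsetP => p pt; apply: contraT => ps.
  by have := pos p pt; rewrite (bc_out HC sC sx ps) ltxx.
by case/andP: (sc2_card HC sC).
Qed.

Definition simplices k : {fset {fset space}} := [fset s in C | #|` s| == k.+1]%fset.

Lemma simplicesP k s : s \in simplices k -> s \in C /\ #|` s| = k.+1.
Proof. by rewrite !inE /= => /andP[-> /eqP ->]. Qed.

Lemma in_simplices k s : s \in C -> #|` s| = k.+1 -> s \in simplices k.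
Proof. by move=> sC sk; rewrite !inE /= sC sk eqxx. Qed.

Definition extend (k : nat) (f : {ffun simplices k -> bool}) (s : {fset space}) : bool :=
  if insub s is Some s' then f s' else false.

Lemma extendE k (f : {ffun simplices k -> bool}) (s : simplices k) : extend f (val s) = f s.
Proof. by rewrite /extend valK. Qed.

Definition vertex_function (f : {ffun simplices 0 -> bool}) (p : space) :=
  extend f [fset p]%fset.

Definition coboundary (kappa : {fset space} -> bool) :=
  exists k : space -> bool, forall e, e \in C -> #|` e| = 2%N -> kappa e = vertex_sum k e.

Lemma vertex_sum_const b0 (e : {fset space}) : #|` e| = 2%N ->
  vertex_sum (fun _ => b0) e = false.
Proof. by move=> /cardfs2P[u [v [uv ->]]]; rewrite vertex_sum2// addbb. Qed.

Lemma vertex_function_sum (k : space -> bool) e : e \in C ->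
  vertex_sum (vertex_function [ffun v : simplices 0 => vertex_sum k (val v)]) e = vertex_sum k e.
Proof.
move=> eC; rewrite /vertex_sum big_seq [RHS]big_seq; apply: eq_bigr => p pe.
have pV : p \in vertices C by apply/vertexP; exists e.
have pS : [fset p]%fset \in simplices 0.
  by apply: in_simplices; [exact: vertex_in pV|rewrite cardfs1].
by rewrite /vertex_function (extendE _ (FSetSub pS)) ffunE /= big_seq_fset1.
Qed.

Lemma edge_sumD (kappa kappa' : {fset space} -> bool) t :
  edge_sum (fun e => kappa e (+) kappa' e) t = edge_sum kappa t (+) edge_sum kappa' t.
Proof. exact: big_split. Qed.

Section UpperBound.
Variables (t0 : simplices 2) (x0 : space) (v0 : space).
Hypotheses (x0_generic : generic_point (val t0) x0) (v0t : v0 \in val t0).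

Let t0C : val t0 \in C. Proof. by have [] := simplicesP (fsvalP t0). Qed.
Let t03 : #|` val t0| = 3%N. Proof. by have [] := simplicesP (fsvalP t0). Qed.

Let alpha (p : space) : R := if p \in val t0 then (bc x0 p)^-1 else 1.

Let alpha_gt0 p : 0 < alpha p.
Proof.
rewrite /alpha; case: ifPn => pt //; rewrite invr_gt0.
by have [_ + _] := x0_generic; apply.
Qed.

Definition off_sums (kappa : {fset space} -> bool) : {ffun simplices 2 -> bool} :=
  [ffun t => (t != t0) && edge_sum kappa (val t)].

Let Kx0 : K x0.
Proof. by have [tx _ _] := x0_generic; exact: hullK tx. Qed.

Let class_cocycle kappa : off_sums kappa = [ffun=> false] ->
  cocycle (K `\` [set x0]) (cochain_class C alpha kappa).
Proof.
move=> off x [Kx xx0].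
apply: (@cocycle_atS _ _ K); first by move=> y [].
apply: (cochain_class_cocycle_at HC alpha_gt0) => // t tC t3 odd tx.
have tS : t \in simplices 2 by exact: in_simplices.
have tE : t = val t0.
  move/ffunP: off => /(_ (FSetSub tS)); rewrite !ffunE /= odd andbT.
  by move/eqP/(congr1 val).
rewrite tE in tx *.
apply: contrapT => H; apply: xx0.
have allmax p : p \in val t0 -> maximal C alpha x p.
  by move=> pt; apply: contrapT => np; apply: H; exists p.
have inV p : p \in val t0 -> p \in vertices C by move=> pt; apply/vertexP; exists (val t0).
have [tx0 pos _] := x0_generic.
pose m := alpha v0 * bc x v0.
have bE p : p \in val t0 -> bc x p = m * bc x0 p.
  move=> pt; have : alpha p * bc x p = m.
    apply/eqP; rewrite eq_le (allmax v0 v0t).2 ?inV//.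
    by rewrite (allmax p pt).2 ?inV.
  rewrite /alpha pt => <-; rewrite mulrAC mulVf ?mul1r// gt_eqF// pos//.
have [_ s1 xE] := bc_barycentric HC t0C tx; have [_ s01 x0E] := bc_barycentric HC t0C tx0.
have m1 : m = 1.
  move: s1; rewrite big_seq (eq_bigr _ bE) -big_seq -mulr_sumr s01 mulr1.
  by [].
rewrite /= xE x0E big_seq [RHS]big_seq; apply: eq_bigr => p pt.
by rewrite bE// m1 mul1r.
Qed.

Let class_coboundary kappa : exact (K `\` [set x0]) (cochain_class C alpha kappa) ->
  coboundary kappa.
Proof.
move=> [g Hg]; exists g => e eC e2; have [u [v [uv eE]]] := cardfs2P e2.
have sub : fset_hull e `<=` K `\` [set x0].
  move=> y ey; split; first exact: hullK ey.
  move=> yx0; have := generic_point_hull t03 eC x0_generic.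
  by rewrite -yx0 => /(_ ey) E; move: t03; rewrite E e2.
have uV : u \in vertices C by apply/vertexP; exists e => //; rewrite eE !inE eqxx.
rewrite eE vertex_sum2//; apply: (cochain_class_exact_edge HC alpha_gt0 uV uv _ _ Hg).
  by rewrite -eE.
by rewrite -eE.
Qed.

(** The weights put the centre of [t0] at [x0]. The sum of the classes of two cochains
    is the class of their sum. *)
Lemma two_cochains kappa kappa' :
  off_sums kappa = [ffun=> false] -> off_sums kappa' = [ffun=> false] ->
  [\/ coboundary kappa, coboundary kappa' |
      coboundary (fun e => kappa e (+) kappa' e)].
Proof.
move=> o1 o2; have [tx0 _ reg] := x0_generic.
have psi_punct y : (P `\` [set phi x0]) y -> (K `\` [set x0]) (psi y).
  by move=> [Py yq]; split; [exact: psi_in|move=> E; apply: yq; rewrite /= -E psiK].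
have phi_punct x : (K `\` [set x0]) x -> (P `\` [set phi x0]) (phi x).
  by move=> [Kx xx]; split; [exact: phi_in|move=> E; apply: xx; rewrite /= -(phiK Kx) E phiK].
have back c : exact (P `\` [set phi x0]) (pullback psi c) -> exact (K `\` [set x0]) c.
  apply: (@exact_section _ _ _ _ psi phi) => //.
    by apply: cont_onS phi_cont => x [].
  by move=> x [Kx _]; exact: phiK.
have cpull kap : off_sums kap = [ffun=> false] ->
    cocycle (P `\` [set phi x0]) (pullback psi (cochain_class C alpha kap)).
  move=> /class_cocycle cc; apply: cocycle_pullback cc => //.
  by apply: cont_onS psi_cont => x [].
have [/back|/back|ex] := punctured_torus_two_classes b_gt0 b_lt_a (phi_in Kx0) reg
    (cpull _ o1) (cpull _ o2).
- by move=> /class_coboundary; apply: Or31.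
- by move=> /class_coboundary; apply: Or32.
apply: Or33; apply: class_coboundary; apply: back.
have [g Hg] := ex; exists g; move: Hg; congr primitive.
apply/funext => y; apply/funext => z; rewrite /addc /pullback /cochain_class /edge_value.
by case: eqP.
Qed.

(** The map [F] is onto. From a vertex function and a bit for each triangle it builds
    an edge cochain: a fixed cochain [base] with the prescribed sums off [t0], plus
    the fixed cochain [k0] if the bit of [t0] is set, plus a coboundary. The constant
    lost in the coboundary is recorded by the value at [v0]. *)
Lemma upper_bound : (#|` simplices 1| + 1 <= #|` simplices 2| + #|` simplices 0|)%N.
Proof.
have /choice[base Hbase] : forall r : {ffun simplices 2 -> bool}, exists kr,
    forall kappa, off_sums kappa = r -> off_sums kr = r.
  move=> r; have [[kr Hr]|H] := pselect (exists kr, off_sums kr = r); first by exists kr.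
  by exists (fun=> false) => kappa E; case: H; exists kappa.
have [k0 Hk0] : exists k0, forall kappa, off_sums kappa = [ffun=> false] ->
    coboundary kappa \/ coboundary (fun e => kappa e (+) k0 e).
  have [[k0 [z0 n0]]|H] := pselect (exists k0, off_sums k0 = [ffun=> false] /\ ~ coboundary k0).
    by exists k0 => kappa o; have [|//|] := two_cochains o z0; [left|right].
  exists (fun=> false) => kappa o; left.
  by apply: contrapT => n; apply: H; exists kappa.
pose off (r : {ffun simplices 2 -> bool}) : {ffun simplices 2 -> bool} :=
  [ffun t => (t != t0) && r t].
pose F (y : {ffun simplices 2 -> bool} * {ffun simplices 0 -> bool}) :
    {ffun simplices 1 -> bool} * bool :=
  ([ffun e => base (off y.1) (val e) (+) (y.1 t0 && k0 (val e)) (+)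
              vertex_sum (vertex_function y.2) (val e)],
   vertex_function y.2 v0).
have := @leq_card_surjective _ _ F; rewrite !card_prod !card_ffun card_bool -!cardfE.
rewrite -expnSr -expnD leq_exp2l// => H.
rewrite addn1; apply: H => -[kap eps].
pose kappa := extend kap; pose rho := off_sums kappa.
pose d e := kappa e (+) base rho e.
have od : off_sums d = [ffun=> false].
  have E := Hbase rho kappa erefl; apply/ffunP => t; rewrite !ffunE edge_sumD.
  move/ffunP: E => /(_ t); rewrite /rho !ffunE.
  by case: (t != t0) => //= ->; rewrite addbb.
have [beta [k Hk]] : exists beta, coboundary (fun e => d e (+) (beta && k0 e)).
  have [[k Hk]|[k Hk]] := Hk0 d od; [exists false|exists true]; exists k => e eC e2.
    by rewrite addbF Hk.
  exact: Hk.
pose k' p := k p (+) (k v0 (+) eps).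
pose r : {ffun simplices 2 -> bool} := [ffun t => if t == t0 then beta else rho t].
have offr : off r = rho.
  by apply/ffunP => t; rewrite !ffunE; case: eqVneq.
have rt0 : r t0 = beta by rewrite ffunE eqxx.
exists (r, [ffun v : simplices 0 => vertex_sum k' (val v)]); rewrite /F /= offr rt0.
congr pair.
  apply/ffunP => e; rewrite ffunE; have [eC e2] := simplicesP (fsvalP e).
  rewrite vertex_function_sum// vertex_sumD vertex_sum_const// addbF -Hk//.
  rewrite /d /kappa extendE.
  by case: (kap e) (base rho _) (_ && _) => [] [] [].
have vS : [fset v0]%fset \in simplices 0.
  apply: in_simplices; last by rewrite cardfs1.
  by apply: (vertex_in HC); apply/vertexP; exists (val t0).
rewrite /vertex_function (extendE _ (FSetSub vS)) ffunE /= /vertex_sum big_seq_fset1 /k'.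
by rewrite addbA addbb.
Qed.

End UpperBound.


Section LowerBound.
Variables (t0 : simplices 2) (v0 : space).
Hypothesis v0t : v0 \in val t0.
Variable x : simplices 2 -> space.
Hypothesis x_generic : forall t, generic_point (val t) (x t).

Let tC (t : simplices 2) : val t \in C. Proof. by have [] := simplicesP (fsvalP t). Qed.
Let t3 (t : simplices 2) : #|` val t| = 3%N. Proof. by have [] := simplicesP (fsvalP t). Qed.
Let Kx t : K (x t). Proof. by have [tx _ _] := x_generic t; exact: hullK tx. Qed.
Let Pq t : P (phi (x t)). Proof. exact: phi_in. Qed.

Let x_hull t s : s \in C -> fset_hull s (x t) -> s = val t.
Proof. by move=> sC sx; rewrite (generic_point_hull (t3 t) sC (x_generic t) sx). Qed.

Variable cl : simplices 2 -> 'rV[R]_3 -> 'rV[R]_3 -> bool.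
Hypothesis cl0 : cl t0 = @handle R.
Hypothesis cl_cocycle : forall t y, P y -> (forall t', y != phi (x t')) -> cocycle_at P (cl t) y.
Hypothesis cl_residue : forall t t', t' != t0 -> residue a b (cl t) (phi (x t')) (t == t').

Definition combination (r : {ffun simplices 2 -> bool}) : 'rV[R]_3 -> 'rV[R]_3 -> bool :=
  fun y z => \big[addb/false]_t (r t && cl t y z).

Let pulled r : space -> space -> bool := pullback phi (combination r).

Let pulled_cocycle_at r s y : s \in C -> fset_hull s y -> (forall t, y != x t) ->
  cocycle_at (fset_hull s) (pulled r) y.
Proof.
move=> sC sy yx; apply: (@cocycle_at_pullback _ _ _ P) => //.
- by apply: cont_onS phi_cont => z; exact: hullK.
- by move=> z sz; apply: phi_in; exact: hullK sz.
have Ky := hullK sC sy.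
apply: cocycle_at_big => t; apply: cocycle_at_mask => _.
apply: cl_cocycle; first exact: phi_in.
move=> t'; apply: contra_neq (yx t') => E.
by rewrite -(phiK Ky) E phiK.
Qed.

Let pulled_cocycle r s : s \in C -> (#|` s| <= 2)%N -> cocycle (fset_hull s) (pulled r).
Proof.
move=> sC s2 y sy; apply: pulled_cocycle_at => // t.
apply/eqP => E; move: s2; rewrite (@x_hull t s) ?t3//.
by rewrite -E.
Qed.

Let combinationD r r' : addc (pulled r) (pulled r') = pulled [ffun t => r t (+) r' t].
Proof.
apply/funext => y; apply/funext => z; rewrite /addc /pulled /pullback /combination -big_split /=.
by apply: eq_bigr => t _; rewrite ffunE; case: (r t) (r' t) => [] [] //=; rewrite ?addbb ?addbF.
Qed.

(** The combination is trivial on the skeleton, so on each punctured triangle, which kills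
    its residues off [t0]. The remaining multiple of [handle] is then trivial on the
    whole surface. *)
Lemma combination_trivial r :
  (exists k, forall e, e \in C -> #|` e| = 2%N -> holonomy (pulled r) e (vertex_sum k e)) ->
  r = [ffun=> false].
Proof.
move=> [k Hk]; have exG := exact_skeleton HC (@pulled_cocycle r) Hk.
have r0 t : t != t0 -> r t = false.
  move=> tt0; have [tx pos reg] := x_generic t.
  have exT : exact (fset_hull (val t) `\` [set x t]) (pulled r).
    apply: (exact_punctured_triangle HC (tC t) (t3 t) tx pos) => //.
    move=> y [ty yx]; apply: (@cocycle_atS _ _ (fset_hull (val t))); first by move=> z [].
    apply: pulled_cocycle_at => // t'; apply/eqP => E.
    move: yx; rewrite E => yx; apply: yx; congr x; apply: val_inj.
    by rewrite (@x_hull t' (val t)) -?E.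
  have nr : residue a b (combination r) (phi (x t)) false.
    have := psi_cont (Pq t); rewrite (phiK (Kx t)).
    move=> /(_ _ (interior_near HC (tC t) (t3 t) tx pos)) nearP.
    have : nbhs (phi (x t)) [set y | P y -> K (psi y) -> fset_hull (val t) (psi y) /\
      forall p, p \in val t -> 0 < bc (psi y) p] := nearP.
    rewrite nbhsE => -[U [oU Uq] UH]; apply: (residue_exact oU Uq).
    apply: (@exact_section _ _ _ _ phi psi _ _ _ _ exT).
    - by apply: cont_onS psi_cont => y [[]].
    - move=> y [[Py Uy] yq]; split.
        by have [] := UH y Uy Py (psi_in Py).
      by move=> E; apply: yq; rewrite /= -E psiK.
    - by move=> y [[Py _] _]; exact: psiK.
  have rr : residue a b (combination r) (phi (x t)) (\big[addb/false]_t' (r t' && (t' == t))).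
    by apply: residue_big => t'; apply: residue_mask; exact: cl_residue.
  move: rr; rewrite (bigD1 t)//= eqxx andbT big1 ?addbF; last first.
    by move=> t' /negbTE ->; rewrite andbF.
  case: (r t) => // rt; case: (residue_unique b_gt0 b_lt_a (Pq t) reg rt nr).
have E : combination r = fun y z => r t0 && handle y z.
  apply/funext => y; apply/funext => z; rewrite /combination (bigD1 t0)//= cl0.
  by rewrite big1 ?addbF// => t /r0 ->.
apply/ffunP => t; rewrite ffunE; have [->|/r0 //] := eqVneq t t0.
apply/negP => rt0; apply: (handle_not_exact b_gt0 b_lt_a).
have {}E : pulled r = pullback phi (@handle R) by rewrite /pulled E rt0.
have exK : exact K (pullback phi (@handle R)).
  rewrite -E; apply: exact_realization => //.
  by rewrite E; apply: cocycle_pullback (handle_cocycle b_gt0 b_lt_a).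
by apply: (@exact_section _ _ _ _ phi psi _ _ _ _ exK).
Qed.

(** The map [F] is injective: it adds to the holonomies of a combination of the
    classes [cl] the coboundary of a vertex function, and records the value of that
    function at [v0]. *)
Lemma lower_bound : (#|` simplices 2| + #|` simplices 0| <= #|` simplices 1| + 1)%N.
Proof.
have /choice[hol Hhol] : forall r, exists h : {fset space} -> bool,
    forall e, e \in C -> #|` e| = 2%N -> holonomy (pulled r) e (h e).
  move=> r; have /choice[h Hh] : forall e, exists d, e \in C -> #|` e| = 2%N ->
      holonomy (pulled r) e d.
    move=> e; have [[eC e2]|H] := pselect (e \in C /\ #|` e| = 2%N); last first.
      by exists false => eC e2; case: H.
    have [d Hd] := holonomy_exists (@pulled_cocycle r e eC (eq_leq e2)).
    by exists d.
  by exists h.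
pose F (y : {ffun simplices 2 -> bool} * {ffun simplices 0 -> bool}) :
    {ffun simplices 1 -> bool} * bool :=
  ([ffun e => hol y.1 (val e) (+) vertex_sum (vertex_function y.2) (val e)],
   vertex_function y.2 v0).
have := @leq_card _ _ F; rewrite !card_prod !card_ffun card_bool -!cardfE.
rewrite -expnSr -expnD leq_exp2l// addn1; apply => -[r k] [r' k'] [Ee Ev].
have {}Ee e : e \in C -> #|` e| = 2%N ->
    hol r e (+) vertex_sum (vertex_function k) e =
    hol r' e (+) vertex_sum (vertex_function k') e.
  move=> eC e2; have eS : e \in simplices 1 by exact: in_simplices.
  by move/ffunP: Ee => /(_ (FSetSub eS)); rewrite !ffunE.
have rr' : r = r'.
  have : [ffun t => r t (+) r' t] = [ffun=> false] :> {ffun simplices 2 -> bool}.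
    apply: combination_trivial.
    exists (fun p => vertex_function k p (+) vertex_function k' p) => e eC e2.
    have := holonomyD (Hhol r e eC e2) (Hhol r' e eC e2); rewrite combinationD.
    congr holonomy; rewrite vertex_sumD; have := Ee e eC e2.
    by case: (hol r e) (hol r' e) (vertex_sum _ e) (vertex_sum _ e) => [] [] [] [].
  move/ffunP => E; apply/ffunP => t; have := E t; rewrite !ffunE.
  by case: (r t) (r' t) => [] [].
rewrite rr' in Ee *; congr pair; apply/ffunP => v.
have [vC v1] := simplicesP (fsvalP v); have /eqP/cardfs1P[p vE] := v1.
have kE (f : {ffun simplices 0 -> bool}) : f v = vertex_function f p.
  by rewrite /vertex_function -[[fset p]%fset]vE extendE.
have pV : p \in vertices C by apply/vertexP; exists (val v) => //; rewrite [val v]vE inE.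
have v0V : v0 \in vertices C by apply/vertexP; exists (val t0).
have := @vertex_function_const _ _ _ HC
  (fun p => vertex_function k p (+) vertex_function k' p) conn_realization _ p v0 pV v0V.
rewrite !kE; move: Ev => /= -> H.
have : vertex_function k p (+) vertex_function k' p = false.
  rewrite H ?addbb// => u w uw eC.
  have e2 : #|` [fset u; w]%fset| = 2%N by rewrite cardfs2 uw.
  have := Ee _ eC e2; rewrite !vertex_sum2//.
  by case: (hol r' _) (vertex_function k u) (vertex_function k w)
    (vertex_function k' u) (vertex_function k' w) => [] [] [] [] [].
by case: (vertex_function k p) (vertex_function k' p) => [] [].
Qed.

End LowerBound.

Lemma euler_count :
  (#|` simplices 2| + #|` simplices 0| = #|` simplices 1| + 1)%N.
Proof.
have [s sC s3] := sc2_dim HC.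
have sS : s \in simplices 2 by exact: in_simplices.
pose t0 : simplices 2 := FSetSub sS.
have /fset0Pn[v0 v0s] : s != fset0 by rewrite -cardfs_gt0 s3.
have /choice[x Hx] : forall t : simplices 2, exists x, generic_point (val t) x.
  by move=> t; have [tC t3] := simplicesP (fsvalP t); exact: generic_point_exists.
have tC (t : simplices 2) : val t \in C by have [] := simplicesP (fsvalP t).
have t3 (t : simplices 2) : #|` val t| = 3%N by have [] := simplicesP (fsvalP t).
have Kx t : K (x t) by have [tx _ _] := Hx t; exact: hullK tx.
have q_inj t t' : t != t' -> phi (x t) != phi (x t').
  apply: contra_neq => E; apply: val_inj; apply: (generic_point_hull (t3 t) (tC t') (Hx t)).
  have -> : x t = x t' by rewrite -[x t]phiK// E phiK.
  by have [] := Hx t'.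
have reg t : phi (x t) 0 1 != 0 by have [] := Hx t.
have /choice[cl Hcl] : forall t, exists c : 'rV[R]_3 -> 'rV[R]_3 -> bool,
    (t = t0 -> c = @handle R) /\
    (forall y, P y -> (t != t0 -> y != phi (x t) /\ y != phi (x t0)) -> cocycle_at P c y) /\
    (t != t0 -> residue a b c (phi (x t)) true).
  move=> t; have [->|tt0] := eqVneq t t0.
    exists (@handle R); split => //; split => // y Py _.
    exact: handle_cocycle.
  have [c Hc rc] := dipole b_gt0 b_lt_a (phi_in (Kx t)) (phi_in (Kx t0)) (reg t) (reg t0)
    (q_inj _ _ tt0).
  exists c; split; first by move/eqP: tt0.
  by split=> // y Py /(_ isT)[y1 y2]; exact: Hc.
apply/eqP; rewrite eqn_leq; apply/andP; split.
  apply: (@lower_bound t0 v0 v0s x Hx cl).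
  - exact: (Hcl t0).1.
  - by move=> t y Py H; apply: (Hcl t).2.1 => // _; split; exact: H.
  - move=> t t' t't0; have [->|tt'] := eqVneq t t'; first exact: (Hcl t').2.2.
    apply: residue_cocycle_at; apply: (Hcl t).2.1 => [|_]; first exact: phi_in.
    by split; apply: q_inj => //; rewrite eq_sym.
by rewrite [leqRHS]addnC addnC [in leqRHS]addnC addnC; exact: (@upper_bound t0 (x t0) v0 (Hx t0) v0s).
Qed.

End Triangulation.

Theorem mainTheorem4 (R : realType) (a b : R) (hb : 0 < b) (hab : b < a)
    (N : nat) (C : {fset {fset 'rV[R]_N}}) (phi : 'rV[R]_N -> 'rV[R]_3)
    (hT : triangulation (pinched_torus a b) C phi) :
  (num_simplices C 0)%:Z - (num_simplices C 1)%:Z + (num_simplices C 2)%:Z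
    = 1 :> int.
Proof.
have [HC [[phi_in phi_inj phi_surj] phi_cont [psi [psi_cont phiK]]]] := hT.
have psiP y : pinched_torus a b y -> realization C (psi y) /\ phi (psi y) = y.
  by move=> /phi_surj[x Kx <-]; rewrite phiK.
have := @euler_count R a b hb hab N C HC phi psi (within_cont_on phi_cont)
  (within_cont_on psi_cont) phi_in (fun y Py => (psiP y Py).1) phiK (fun y Py => (psiP y Py).2).
rewrite /simplices -/(num_simplices C 0) -/(num_simplices C 1) -/(num_simplices C 2) => E.
by rewrite addrAC -PoszD addnC E PoszD addrAC subrr add0r.
Qed.
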